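(* Consider an $L$-layer holomorphic multilayer perceptron (as described in the context) whose activation functions satisfy $\overline{g_p(z)}=g_p(\overline z)$ for $p=1,\dots,L$, together with a training set of $N$ points and the sum-of-squares error function $E$. Then for $p=1,\dots,L$ the weight updates of the backpropagation algorithm with the pseudo-Newton's method are given by $$\Delta\mathbf w^{(p-1)}=-\mathcal H_{\mathbf w^{(p-1)}\mathbf w^{(p-1)}}^{-1}\left(\frac{\partial E}{\partial\mathbf w^{(p-1)}}\right)^*,$$ where for $1\le p\le L$ the entries of the Hessian matrix $\mathcal H_{\mathbf w^{(p-1)}\mathbf w^{(p-1)}}$ are $$\frac{\partial}{\partial w^{(p-1)}_{ba}}\left(\frac{\partial E}{\partial w^{(p-1)}_{ji}}\right)^*=\frac1N\sum_{t=1}^N\gamma^{(p)}_{tjb}\,\overline{x^{(p-1)}_{ti}}\,x^{(p-1)}_{ta},\qquad j,b=1,\dots,K_p,\ i,a=1,\dots,K_{p-1},$$ with, for $t=1,\dots,N$, $\gamma^{(L)}_{tkl}=g_L'(\overline{y^{\mathrm{net}}_{tl}})\,g_L'(y^{\mathrm{net}}_{tl})$ if $k=l$ and $\gamma^{(L)}_{tkl}=0$ if $k\ne l$ ($k,l=1,\dots,C$), and for $p=1,\dots,L-1$ and $j,b=1,\dots,K_p$, $$\gamma^{(p)}_{tjb}=\left[\sum_{\eta=1}^{K_{p+1}}\sum_{\beta=1}^{K_{p+1}}\gamma^{(p+1)}_{t\eta\beta}\,\overline{w^{(p)}_{\eta j}}\,w^{(p)}_{\beta b}\right]g_p'\left(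\overline{(x^{(p)}_{tj})^{\mathrm{net}}}\right)g_p'\left((x^{(p)}_{tb})^{\mathrm{net}}\right).$$
   Context: Network. Fix $L\ge1$ and layer sizes $K_0=m,K_1,\dots,K_L=C$. For $p=1,\dots,L$ the activation function $g_p$ of layer $p$ is holomorphic on a domain $\Omega_p\subseteq\mathbb C$ (closed under complex conjugation, so that $\overline{g_p(z)}=g_p(\overline z)$ is meaningful on it). The complex weights into layer $p$ are $w^{(p-1)}_{ji}$, $j=1,\dots,K_p$ (target node), $i=1,\dots,K_{p-1}$ (source node). The training set is $\{(z_{t1},\dots,z_{tm},d_{t1},\dots,d_{tC}): t=1,\dots,N\}$, with complex inputs $z_{ti}$ and desired outputs $d_{tl}$. For each $t$, $x^{(0)}_{ti}=z_{ti}$, and for $p=1,\dots,L$, $$(x^{(p)}_{tj})^{\mathrm{net}}=\sum_{i=1}^{K_{p-1}}w^{(p-1)}_{ji}x^{(p-1)}_{ti},\qquad x^{(p)}_{tj}=g_p\left((x^{(p)}_{tj})^{\mathrm{net}}\right),$$ all net sums being in the corresponding $\Omega_p$. Write $y_{tl}=x^{(L)}_{tl}$ and $y^{\mathrm{net}}_{tl}=(x^{(L)}_{tl})^{\mathrm{net}}$. The error function is $E=\frac1N\sum_{t=1}^N\sum_{l=1}^C|y_{tl}-d_{tl}|^2$. Weight vectors. $\mathbf w^{(p-1)}$ is the column vector with component number $(j-1)K_{p-1}+i$ equal to $w^{(p-1)}_{ji}$. Derivatives. $\frac{\partial}{\partial w}=\frac12\left(\frac{\partial}{\partial u}-i\frac{\partial}{\partial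 v}\right)$ and $\frac{\partial}{\partial\overline w}=\frac12\left(\frac{\partial}{\partial u}+i\frac{\partial}{\partial v}\right)$ for $w=u+iv$ are Wirtinger derivatives. $\frac{\partial E}{\partial\mathbf w}$ and $\frac{\partial E}{\partial\overline{\mathbf w}}$ are row vectors of Wirtinger derivatives (the weights of the other layers being held fixed), and $^*$ is conjugate transpose (complex conjugation for scalars). Define $\mathcal H_{\mathbf w\mathbf w}=\frac{\partial}{\partial\mathbf w}\left(\frac{\partial E}{\partial\mathbf w}\right)^*$, $\mathcal H_{\overline{\mathbf w}\mathbf w}=\frac{\partial}{\partial\overline{\mathbf w}}\left(\frac{\partial E}{\partial\mathbf w}\right)^*$, $\mathcal H_{\mathbf w\overline{\mathbf w}}=\frac{\partial}{\partial\mathbf w}\left(\frac{\partial E}{\partial\overline{\mathbf w}}\right)^*$, $\mathcal H_{\overline{\mathbf w}\overline{\mathbf w}}=\frac{\partial}{\partial\overline{\mathbf w}}\left(\frac{\partial E}{\partial\overline{\mathbf w}}\right)^*$ (Jacobian matrices of column vectors). For $\mathbf w=\mathbf w^{(p-1)}$ the entry in row $(j-1)K_{p-1}+i$ and column $(b-1)K_{p-1}+a$ of $\mathcal H_{\mathbf w\mathbf w}$ is $\frac{\partial}{\partial w^{(p-1)}_{ba}}\left(\frac{\partial E}{\partial w^{(p-1)}_{ji}}\right)^*$. Newton and pseudo-Newton. The Newton weight update is $$\Delta\mathbf w=\left(\mathcal H_{\mathbf w\mathbf w}-\mathcal H_{\overline{\mathbf w}\mathbf w}\mathcal H_{\overline{\mathbf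 w}\overline{\mathbf w}}^{-1}\mathcal H_{\mathbf w\overline{\mathbf w}}\right)^{-1}\left[\mathcal H_{\overline{\mathbf w}\mathbf w}\mathcal H_{\overline{\mathbf w}\overline{\mathbf w}}^{-1}\left(\frac{\partial E}{\partial\overline{\mathbf w}}\right)^*-\left(\frac{\partial E}{\partial\mathbf w}\right)^*\right].$$ The pseudo-Newton update is by definition what this formula becomes when $\mathcal H_{\overline{\mathbf w}\mathbf w}$ and $\mathcal H_{\mathbf w\overline{\mathbf w}}$ are replaced by $0$ (when the inverses occurring exist). Backpropagation updates $\mathbf w^{(p-1)}(n+1)=\mathbf w^{(p-1)}(n)+\mu(n)\Delta\mathbf w^{(p-1)}$ with steplength $\mu(n)$, layer by layer starting from the output layer, each time using the current weights. *)

(* Defs.v *)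
From HB Require Import structures.
From mathcomp Require Import all_boot all_order all_algebra.
From mathcomp Require Import complex.
From mathcomp Require Import all_classical all_reals all_analysis.

Set Implicit Arguments.
Unset Strict Implicit.
Unset Printing Implicit Defensive.

Import Order.TTheory GRing.Theory Num.Theory.
Import numFieldNormedType.Exports.

Local Open Scope ring_scope.
Local Open Scope classical_set_scope.
Local Open Scope sesquilinear_scope.

(* The topology of R[i] is carried by the alias R[i]^o, whence the casts to ^o
   below.  Complex conjugation is z^* and conjugate transposition is A ^t*. *)

Section Holomorphy.
Variable R : realType.
Local Notation C := R[i].

Definition complex_domain (D : set C) : Prop :=
  [/\ D !=set0, open (D : set C^o) & connected (D : set C^o)].

Definition holomorphic_on (D : set C) (f : C -> C) : Prop :=
  forall z, D z -> derivable (f : C^o -> C^o) z 1.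

Definition cderiv (f : C -> C) (z : C) : C := derive1 (f : C^o -> C^o) z.

End Holomorphy.

Section Wirtinger.
Variable R : realType.
Local Notation C := R[i].
Implicit Types (f : C -> C) (z : C).

(* With z = u + i v, du and dv are the partial derivatives in u and v.  They are
   taken on the real and imaginary parts of f because the library has no normed
   module structure on R[i] over R. *)
Definition du f z : C :=
  Complex (derive1 (fun s : R => complex.Re (f (z + Complex s 0))) 0)
          (derive1 (fun s : R => complex.Im (f (z + Complex s 0))) 0).

Definition dv f z : C :=
  Complex (derive1 (fun s : R => complex.Re (f (z + Complex 0 s))) 0)
          (derive1 (fun s : R => complex.Im (f (z + Complex 0 s))) 0).

Definition dw f z : C := 2^-1 * (du f z - 'i%C * dv f z).

Definition dwbar f z : C := 2^-1 * (du f z + 'i%C * dv f z).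

Definition wirtinger_derivable f z : Prop :=
  [/\ derivable (fun s : R => complex.Re (f (z + Complex s 0))) 0 1,
      derivable (fun s : R => complex.Im (f (z + Complex s 0))) 0 1,
      derivable (fun s : R => complex.Re (f (z + Complex 0 s))) 0 1
    & derivable (fun s : R => complex.Im (f (z + Complex 0 s))) 0 1].

(* In what follows the operator D is dw or dwbar. *)

Definition along n (f : 'cV[C]_n -> C) (v : 'cV[C]_n) (c : 'I_n) : C -> C :=
  fun s => f (v + s *: delta_mx c 0).

Definition partial (D : (C -> C) -> C -> C) n (f : 'cV[C]_n -> C)
  (v : 'cV[C]_n) (c : 'I_n) : C := D (along f v c) 0.

Definition partial_derivable n (f : 'cV[C]_n -> C) (v : 'cV[C]_n) (c : 'I_n) :=
  wirtinger_derivable (along f v c) 0.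

Definition grad D n (f : 'cV[C]_n -> C) (v : 'cV[C]_n) : 'rV[C]_n :=
  \row_c partial D f v c.

Definition jacobian_mx D m n (f : 'cV[C]_n -> 'cV[C]_m) (v : 'cV[C]_n) :
  'M[C]_(m, n) := \matrix_(r, c) partial D (fun u => f u r 0) v c.

(* [hess D1 D2 f] differentiates by D1 the column (D2 f)^*:
   H_ww = hess dw dw, H_{wbar w} = hess dwbar dw,
   H_{w wbar} = hess dw dwbar, H_{wbar wbar} = hess dwbar dwbar. *)
Definition hess D1 D2 n (f : 'cV[C]_n -> C) (v : 'cV[C]_n) : 'M[C]_n :=
  jacobian_mx D1 (fun u => (grad D2 f u) ^t*) v.

Definition newton_formula n (Hww Hcw Hwc Hcc : 'M[C]_n) (gw gc : 'rV[C]_n) :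
  'cV[C]_n :=
  invmx (Hww - Hcw *m invmx Hcc *m Hwc) *m
    (Hcw *m invmx Hcc *m gc ^t* - gw ^t*).

Definition newton_update n (f : 'cV[C]_n -> C) (v : 'cV[C]_n) : 'cV[C]_n :=
  newton_formula (hess dw dw f v) (hess dwbar dw f v) (hess dw dwbar f v)
    (hess dwbar dwbar f v) (grad dw f v) (grad dwbar f v).

Definition pseudo_newton_update n (f : 'cV[C]_n -> C) (v : 'cV[C]_n) :
  'cV[C]_n :=
  newton_formula (hess dw dw f v) 0 0
    (hess dwbar dwbar f v) (grad dw f v) (grad dwbar f v).

End Wirtinger.

Section WeightVector.
Variables (R : realType) (m n : nat).
Local Notation C := R[i].

Definition to_vec (A : 'M[C]_(m, n)) : 'cV[C]_(m * n) := (mxvec A)^T.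
Definition of_vec (v : 'cV[C]_(m * n)) : 'M[C]_(m, n) := vec_mx v^T.

End WeightVector.

(* With 0-based indices, component number j * n + i of the weight vector is the
   entry (j, i). *)
Lemma val_mxvec_index m n (j : 'I_m) (i : 'I_n) :
  mxvec_index j i = (j * n + i)%N :> nat.
Proof.
have E s : j \in s -> index (j, i) [seq (a, b) | a <- s, b <- enum 'I_n]
  = (index j s * n + i)%N.
  elim: s => //= a s IH; rewrite inE index_cat eq_sym.
  case: eqVneq => [->|ne] /= js.
    rewrite map_f ?mem_enum // index_map ?index_enum_ord //.
    by move=> b c [].
  rewrite ifF; first by rewrite IH // size_map size_enum_ord mulSn addnA.
  by apply/negbTE/mapP => -[b _ [e _]]; rewrite e eqxx in ne.
rewrite /mxvec_index /= /enum_rank enum_rank_in.unlock insubdK.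
  by rewrite enumT Finite.enum.unlock /= /prod_enum E ?mem_enum // index_enum_ord.
by rewrite cardE [_ \in _]index_mem mem_enum.
Qed.

Section Network.
Variables (R : realType) (L : nat) (K : nat -> nat) (N : nat).
Local Notation C := R[i].
Variables (g : nat -> C -> C).
Variables (z : 'I_N -> 'cV[C]_(K 0%N)) (d : 'I_N -> 'cV[C]_(K L)).

(* [w p] is the matrix of the weights from layer p into layer p.+1; only
   p < L matters.  Likewise only the g p with 1 <= p <= L matter. *)
Definition weights := forall p : nat, 'M[C]_(K p.+1, K p).
Implicit Types (w : weights) (t : 'I_N) (p : nat).

Fixpoint act w t p : 'cV[C]_(K p) :=
  match p with
  | 0 => z t
  | q.+1 => map_mx (g q.+1) (w q *m act w t q)
  end.

(* net input of layer p.+1 *)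
Definition net w t p : 'cV[C]_(K p.+1) := w p *m act w t p.

Definition admissible (Omega : nat -> set C) w : Prop :=
  forall t p (j : 'I_(K p.+1)), (p < L)%N -> Omega p.+1 (net w t p j 0).

Definition error w : C :=
  N%:R^-1 * \sum_(t < N) \sum_(l < K L) `|act w t L l 0 - d t l 0| ^+ 2.

(* the error as a function of the weight vector into layer p.+1 *)
Definition layer_error w p (v : 'cV[C]_(K p.+1 * K p)) : C :=
  error (dfwith w p (of_vec v)).

(* [gamma_rec w t k p] is the coefficient matrix of layer p.+1, reached by k
   steps of the recursion from layer p.+1 + k. *)
Fixpoint gamma_rec w t (k p : nat) : 'M[C]_(K p.+1) :=
  match k with
  | 0 => \matrix_(j, b)
      if j == b
      then cderiv (g p.+1) ((net w t p b 0)^*) * cderiv (g p.+1) (net w t p b 0)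
      else 0
  | k'.+1 => \matrix_(j, b)
      ((\sum_eta \sum_beta gamma_rec w t k' p.+1 eta beta
          * (w p.+1 eta j)^* * w p.+1 beta b)
       * cderiv (g p.+1) ((net w t p j 0)^*) * cderiv (g p.+1) (net w t p b 0))
  end.

Definition gamma w t p : 'M[C]_(K p.+1) := gamma_rec w t (L - p.+1) p.

Lemma gamma_last w t p : p.+1 = L -> forall j b : 'I_(K p.+1),
  gamma w t p j b =
    if j == b
    then cderiv (g p.+1) ((net w t p b 0)^*) * cderiv (g p.+1) (net w t p b 0)
    else 0.
Proof.
move=> pL j b; have e : (L - p.+1 = 0)%N by rewrite pL subnn.
by rewrite /gamma e mxE.
Qed.

Lemma gamma_step w t p : (p.+1 < L)%N -> forall j b : 'I_(K p.+1),
  gamma w t p j b =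
    (\sum_eta \sum_beta gamma w t p.+1 eta beta
        * (w p.+1 eta j)^* * w p.+1 beta b)
    * cderiv (g p.+1) ((net w t p j 0)^*) * cderiv (g p.+1) (net w t p b 0).
Proof. by move=> pL j b; rewrite {1}/gamma -subnSK // mxE. Qed.

Section Backpropagation.
Variable update : forall w p, 'cV[C]_(K p.+1 * K p).
Arguments update : clear implicits.

Definition update_layer (mu : R) w p : weights :=
  dfwith w p (of_vec (to_vec (w p) + Complex mu 0 *: update w p)).

(* weights after the k layers L, L - 1, ..., L - k + 1 have been updated *)
Fixpoint sweep (mu : R) (k : nat) w : weights :=
  match k with
  | 0 => w
  | k'.+1 => update_layer mu (sweep mu k' w) (L - k'.+1)
  end.

Fixpoint backprop (mu : nat -> R) w (n : nat) : weights :=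
  match n with
  | 0 => w
  | n'.+1 => sweep (mu n') L (backprop mu w n')
  end.

(* weights in use when layer p.+1 is updated in iteration n *)
Definition current (mu : nat -> R) w (n p : nat) : weights :=
  sweep (mu n) (L - p.+1) (backprop mu w n).

End Backpropagation.

Definition pseudo_newton w p : 'cV[C]_(K p.+1 * K p) :=
  pseudo_newton_update (layer_error w (p := p)) (to_vec (w p)).

Definition error_grad w p : 'rV[C]_(K p.+1 * K p) :=
  grad (@dw R) (layer_error w (p := p)) (to_vec (w p)).

Definition error_hess w p : 'M[C]_(K p.+1 * K p) :=
  hess (@dw R) (@dw R) (layer_error w (p := p)) (to_vec (w p)).

End Network.

(* Main.v *)
Require Import Defs.
From mathcomp Require Import all_boot all_order all_algebra.
From mathcomp Require Import complex.
From mathcomp Require Import all_classical all_reals all_analysis.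
From mathcomp Require Import ring lra zify.

Set Implicit Arguments.
Unset Strict Implicit.
Unset Printing Implicit Defensive.

Import Order.TTheory GRing.Theory Num.Theory.
Import numFieldNormedType.Exports.

Local Open Scope ring_scope.
Local Open Scope sesquilinear_scope.

(** The error is a sum of squared moduli [(y - d) * conj (y - d)] in which every
output [y] is a holomorphic function of one weight when the others are held
fixed.  The conjugate of a holomorphic function has zero derivative with respect
to [w], so differentiating [E] in the weight [r] and conjugating gives
[N^-1 * sum (y - d) * conj (D_r y)].  Here [conj (D_r y)] is antiholomorphic,
hence constant for a second derivative in the weight [c], and the Hessian
entry is the sesquilinear form [N^-1 * sum (D_c y) * conj (D_r y)].  The matrix
[gamma] of a layer is this form written in the derivatives of the net inputs of
that layer: going one layer down multiplies these derivatives by [g'] and by the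
weights, and using the conjugation symmetry [conj (g' s) = g' (conj s)] this is
exactly the recursion for [gamma] ([gamma_pairing], [error_hessE]).  In the
layer of the weights themselves the derivatives of the net inputs are the inputs
of the layer, which yields the stated entries.

The step that is not formal is that [D_r y] can be differentiated again.  It
contains [g'], so one needs that the derivative of a function which is merely
complex differentiable on an open set is itself complex differentiable
([holomorphic_deriv_differentiable]).  This is Goursat's theorem together with
Cauchy's formula, proved here on the unit square.  Integrals along the sides are
ultrafilter limits of Riemann sums: this limit exists for all bounded
functions, is linear and additive in the interval, and maps functions close to a
constant close to the integral of that constant, and nothing else about
integration is used.  In Goursat's bisection argument one point is allowed
where the integrand is only bounded nearby, so that the argument applies
directly to [(f s - f z) / (s - z)].  The result is
[f z * v z = u z] near the center of the square, where [u] and [v] are the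
Cauchy integrals of [f] and of [1]; these can be differentiated twice under the
integral sign, and [v] does not vanish at the center.

All first order statements use one notion, [rdiff f z a b], which says
[f (z + h) = f z + a * h + b * conj h + o(h)].  Its coefficients are the two
Wirtinger derivatives, it has the rules of a calculus, and the holomorphic case
is [b = 0]. *)

(** * The modulus of a complex number *)

Section Modulus.
Variable R : realType.
Local Notation C := R[i].
Implicit Types x y : C.

(** The norm of [R[i]] takes values in [R[i]]; estimates are carried out with
this real-valued version, where the ordering is total. *)
Definition cmod x : R := Normc.normc x.
Arguments cmod : simpl never.

Lemma normE x : `|x| = Complex (cmod x) 0.
Proof. by []. Qed.

Lemma cmod_ge0 x : 0 <= cmod x.
Proof. by case: x => a b; exact: sqrtr_ge0. Qed.

Lemma cmodM x y : cmod (x * y) = cmod x * cmod y.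
Proof. exact: Normc.normcM. Qed.

Lemma cmodV x : cmod x^-1 = (cmod x)^-1.
Proof. exact: Normc.normcV. Qed.

Lemma cmodN x : cmod (- x) = cmod x.
Proof. exact: normcN. Qed.

Lemma cmodD x y : cmod (x + y) <= cmod x + cmod y.
Proof. exact: le_normcD. Qed.

Lemma cmodB x y : cmod (x - y) <= cmod x + cmod y.
Proof. by rewrite -(cmodN y); exact: cmodD. Qed.

Lemma cmod0 : cmod 0 = 0.
Proof. exact: Normc.normc0. Qed.

Lemma cmod_eq0 x : (cmod x == 0) = (x == 0).
Proof. by apply/eqP/eqP => [/Normc.eq0_normc//|->]; exact: cmod0. Qed.

Lemma cmod_gt0 x : (0 < cmod x) = (x != 0).
Proof. by rewrite lt_def cmod_ge0 andbT cmod_eq0. Qed.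

Lemma cmod_real (r : R) : cmod (Complex r 0) = `|r|.
Proof. by rewrite /cmod /= expr0n addr0 sqrtr_sqr. Qed.

Lemma cmod_imag (r : R) : cmod (Complex 0 r) = `|r|.
Proof. by rewrite /cmod /= expr0n add0r sqrtr_sqr. Qed.

Lemma cmod_i : cmod 'i%C = 1.
Proof. by rewrite cmod_imag normr1. Qed.

Lemma cmodJ x : cmod x^* = cmod x.
Proof. by case: x => a b; rewrite /cmod /= sqrrN. Qed.

Lemma ge_Re_cmod x : `|complex.Re x| <= cmod x.
Proof.
case: x => a b; rewrite /cmod /= -sqrtr_sqr ler_wsqrtr // lerDl; exact: sqr_ge0.
Qed.

Lemma ge_Im_cmod x : `|complex.Im x| <= cmod x.
Proof.
case: x => a b; rewrite /cmod /= -sqrtr_sqr ler_wsqrtr // lerDr; exact: sqr_ge0.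
Qed.

Lemma cmod_le_ReIm x : cmod x <= `|complex.Re x| + `|complex.Im x|.
Proof.
case: x => a b; rewrite /= -(cmod_real a) -(cmod_imag b).
have -> : Complex a b = Complex a 0 + Complex 0 b.
  by apply/eqP; rewrite eq_complex /= addr0 add0r !eqxx.
exact: cmodD.
Qed.

End Modulus.

(** * Real differentiability with complex coefficients *)
Section RealDifferentiability.
Variable R : realType.
Local Notation C := R[i].
Implicit Types (f g : C -> C) (z a b c : C).

Definition little_o (r : C -> C) := forall e : R, 0 < e ->
  exists2 d : R, 0 < d & forall h, cmod h < d -> cmod (r h) <= e * cmod h.

Definition rdiff f z a b :=
  little_o (fun h => f (z + h) - f z - (a * h + b * h^*)).

Lemma little_o_near r s (d : R) : 0 < d ->
  (forall h, cmod h < d -> r h = s h) -> little_o r -> little_o s.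
Proof.
move=> d0 rs ro e e0; have [d' d'0 H] := ro e e0.
exists (Num.min d d'); first by rewrite lt_min d0.
by move=> h; rewrite lt_min => /andP[h1 h2]; rewrite -rs // H.
Qed.

Lemma little_oD r s : little_o r -> little_o s ->
  little_o (fun h => r h + s h).
Proof.
move=> ro so e e0; have e20 : 0 < e / 2 by lra.
have [d1 d10 H1] := ro _ e20; have [d2 d20 H2] := so _ e20.
exists (Num.min d1 d2); first by rewrite lt_min d10.
move=> h; rewrite lt_min => /andP[/H1 h1 /H2 h2].
by have := cmodD (r h) (s h); lra.
Qed.

Lemma little_o_bounded c r s : little_o r ->
  (forall h, cmod (s h) <= cmod c * cmod (r h)) -> little_o s.
Proof.
move=> ro sr e e0; have c0 := cmod_ge0 c.
have e'0 : 0 < e / (cmod c + 1) by rewrite divr_gt0 //; lra.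
have [d d0 H] := ro _ e'0; exists d => // h /H h1.
apply: (le_trans (sr h)); apply: (le_trans (ler_wpM2l c0 h1)).
rewrite mulrA ler_wpM2r ?cmod_ge0 //.
by rewrite mulrA ler_pdivrMr; nra.
Qed.

Lemma little_oMl c r : little_o r -> little_o (fun h => c * r h).
Proof.
by move=> ro; apply: (little_o_bounded (c := c) ro) => h; rewrite cmodM.
Qed.

Lemma little_o_quadratic r (k d : R) : 0 < d -> 0 <= k ->
  (forall h, cmod h < d -> cmod (r h) <= k * cmod h ^+ 2) -> little_o r.
Proof.
move=> d0 k0 H e e0; have e'0 : 0 < e / (k + 1) by rewrite divr_gt0 //; lra.
exists (Num.min d (e / (k + 1))); first by rewrite lt_min d0.
move=> h; rewrite lt_min => /andP[/H h1 h2]; apply: (le_trans h1).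
rewrite expr2 mulrA ler_wpM2r ?cmod_ge0 //.
move: h2; rewrite ltr_pdivlMr; first by have := cmod_ge0 h; nra.
lra.
Qed.

(** Differentiability at a point depends on the germ only; this also serves to
replace a function by a pointwise equal one. *)
Lemma rdiff_near f g z a b (d : R) : 0 < d ->
  (forall h, cmod h < d -> f (z + h) = g (z + h)) ->
  rdiff f z a b -> rdiff g z a b.
Proof.
move=> d0 fg; apply: (little_o_near d0) => h hd; rewrite fg //.
by have := fg 0; rewrite addr0 cmod0 => ->.
Qed.

Lemma rdiff_lipschitz f z a b : rdiff f z a b ->
  exists2 k : R, 0 <= k & exists2 d : R, 0 < d &
    forall h, cmod h < d -> cmod (f (z + h) - f z) <= k * cmod h.
Proof.
move=> /(_ 1 ltr01)[d d0 H]; have a0 := cmod_ge0 a; have b0 := cmod_ge0 b.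
exists (1 + cmod a + cmod b); first by lra.
exists d => // h /H h1.
have := cmodD (f (z + h) - f z - (a * h + b * h^*)) (a * h + b * h^*).
rewrite subrK => h2; apply: (le_trans h2).
have := cmodD (a * h) (b * h^*); rewrite !cmodM cmodJ; lra.
Qed.

Lemma rdiff_continuous f z a b : rdiff f z a b -> forall e : R, 0 < e ->
  exists2 d : R, 0 < d & forall h, cmod h < d -> cmod (f (z + h) - f z) < e.
Proof.
move=> /rdiff_lipschitz[k k0 [d d0 H]] e e0.
have e'0 : 0 < e / (k + 1) by rewrite divr_gt0 //; lra.
exists (Num.min d (e / (k + 1))); first by rewrite lt_min d0.
move=> h; rewrite lt_min => /andP[/H h1 h2]; apply: (le_lt_trans h1).
move: h2; rewrite ltr_pdivlMr; last by lra.
by have := cmod_ge0 h; nra.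
Qed.

Lemma rdiff_cst c z : rdiff (fun=> c) z 0 0.
Proof.
move=> e e0; exists 1 => // h _.
by rewrite !mul0r addr0 subrr subr0 cmod0 mulr_ge0 ?cmod_ge0 // ltW.
Qed.

Lemma rdiff_id z : rdiff id z 1 0.
Proof.
move=> e e0; exists 1 => // h _.
have -> : z + h - z - (1 * h + 0 * h^*) = 0 by ring.
by rewrite cmod0 mulr_ge0 ?cmod_ge0 // ltW.
Qed.

Lemma rdiff_conj f z a b : rdiff f z a b -> rdiff (fun s => (f s)^*) z b^* a^*.
Proof.
move=> fo e /fo[d d0 H]; exists d => // h /H.
have -> : (f (z + h))^* - (f z)^* - (b^* * h + a^* * h^*) =
          (f (z + h) - f z - (a * h + b * h^*))^*.
  by rewrite !(rmorphB, rmorphD, rmorphM) /= (conjCK h); ring.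
by rewrite cmodJ.
Qed.

Lemma rdiff_conj_conj f z a b : rdiff f z a b ->
  rdiff (fun s => (f s^*)^*) z^* a^* b^*.
Proof.
move=> fo e /fo[d d0 H]; exists d => // h.
rewrite -cmodJ => /H.
have -> : (f (z^* + h)^*)^* - (f z^*^*)^* - (a^* * h + b^* * h^*) =
          (f (z + h^*) - f z - (a * h^* + b * h^*^*))^*.
  by rewrite !(rmorphB, rmorphD, rmorphM) /= (conjCK h) (conjCK z).
by rewrite [cmod (_ - _)^*]cmodJ.
Qed.

Lemma rdiffD f g z a b a' b' : rdiff f z a b -> rdiff g z a' b' ->
  rdiff (fun s => f s + g s) z (a + a') (b + b').
Proof.
move=> fo go; apply: (little_o_near ltr01 _ (little_oD fo go)) => h _; ring.
Qed.

Lemma rdiffM f g z a b a' b' : rdiff f z a b -> rdiff g z a' b' ->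
  rdiff (fun s => f s * g s) z (a * g z + f z * a') (b * g z + f z * b').
Proof.
move=> fo go.
(* The remainder of a product is linear in the two remainders, up to the product
   of the increments, which is of second order. *)
have q : little_o (fun h => (f (z + h) - f z) * (g (z + h) - g z)).
  have [k k0 [d d0 H]] := rdiff_lipschitz fo.
  have [k' k'0 [d' d'0 H']] := rdiff_lipschitz go.
  apply: (@little_o_quadratic _ (k * k') (Num.min d d')).
  - by rewrite lt_min d0.
  - exact: mulr_ge0.
  - move=> h; rewrite lt_min => /andP[/H h1 /H' h2]; rewrite cmodM expr2 mulrACA.
    by apply: ler_pM => //; exact: cmod_ge0.
have s := little_oD (little_oD (little_oMl (g z) fo) (little_oMl (f z) go)) q.
by apply: (little_o_near ltr01 _ s) => h _; ring.
Qed.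

Lemma rdiffMl c f z a b : rdiff f z a b ->
  rdiff (fun s => c * f s) z (c * a) (c * b).
Proof.
by move=> fo; have := rdiffM (rdiff_cst c z) fo; rewrite !mul0r !add0r.
Qed.

Lemma rdiffN f z a b : rdiff f z a b -> rdiff (fun s => - f s) z (- a) (- b).
Proof.
move=> /(rdiffMl (-1)); rewrite !mulN1r.
by apply: (rdiff_near ltr01) => h _; rewrite mulN1r.
Qed.

Lemma rdiffB f g z a b a' b' : rdiff f z a b -> rdiff g z a' b' ->
  rdiff (fun s => f s - g s) z (a - a') (b - b').
Proof. by move=> fo /rdiffN; exact: rdiffD. Qed.

Lemma rdiff_sum (I : finType) (F : I -> C -> C) (A B : I -> C) z :
  (forall i, rdiff (F i) z (A i) (B i)) ->
  rdiff (fun s => \sum_i F i s) z (\sum_i A i) (\sum_i B i).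
Proof.
move=> H; elim: (index_enum I) => [|i r IH].
  rewrite !big_nil; apply: (rdiff_near ltr01) (rdiff_cst 0 z) => h _.
  by rewrite big_nil.
rewrite !big_cons; apply: (rdiff_near ltr01) (rdiffD (H i) IH) => h _.
by rewrite big_cons.
Qed.

(** For a holomorphic outer function both coefficients of the inner one are
multiplied by the complex derivative. *)
Lemma rdiff_comp g f z c a b : rdiff g (f z) c 0 -> rdiff f z a b ->
  rdiff (g \o f) z (c * a) (c * b).
Proof.
move=> go fo.
have [k k0 [d d0 H]] := rdiff_lipschitz fo.
have q : little_o (fun h => let w := f (z + h) - f z in
    g (f z + w) - g (f z) - (c * w + 0 * w^*)).
  move=> e e0; have e'0 : 0 < e / (k + 1) by rewrite divr_gt0 //; lra.
  have [d' d'0 H'] := go _ e'0.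
  have [d'' d''0 H''] := rdiff_continuous fo d'0.
  exists (Num.min d d''); first by rewrite lt_min d0.
  move=> h; rewrite lt_min => /andP[/H h1 /H''/H' h2] /=.
  apply: (le_trans h2); rewrite mulrAC ler_pdivrMr; last by lra.
  rewrite -mulrA ler_pM2l //; apply: (le_trans h1).
  by rewrite mulrC ler_wpM2l ?cmod_ge0 //; lra.
apply: (little_o_near ltr01 _ (little_oD q (little_oMl c fo))) => h _ /=.
have -> : f z + (f (z + h) - f z) = f (z + h) by ring.
ring.
Qed.

Lemma cdiffD f g z a a' : rdiff f z a 0 -> rdiff g z a' 0 ->
  rdiff (fun s => f s + g s) z (a + a') 0.
Proof. by move=> fo go; have := rdiffD fo go; rewrite addr0. Qed.

Lemma cdiffM f g z a a' : rdiff f z a 0 -> rdiff g z a' 0 ->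
  rdiff (fun s => f s * g s) z (a * g z + f z * a') 0.
Proof. by move=> fo go; have := rdiffM fo go; rewrite mulr0 mul0r addr0. Qed.

Lemma cdiff_comp g f z c a : rdiff g (f z) c 0 -> rdiff f z a 0 ->
  rdiff (g \o f) z (c * a) 0.
Proof. by move=> go fo; have := rdiff_comp go fo; rewrite mulr0. Qed.

Lemma rdiffV z : z != 0 -> rdiff (fun s => s^-1) z (- z^-1 ^+ 2) 0.
Proof.
move=> z0; have z0' : 0 < cmod z by rewrite cmod_gt0.
apply: (@little_o_quadratic _ (2 * (cmod z)^-1 ^+ 3) (cmod z / 2)); first by lra.
  by rewrite mulr_ge0 // exprn_ge0 // invr_ge0 ltW.
move=> h hz.
have zh : cmod z / 2 <= cmod (z + h).
  by have := cmodB (z + h) h; rewrite addrK; lra.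
have zh0 : z + h != 0 by rewrite -cmod_gt0; lra.
have -> : (z + h)^-1 - z^-1 - (- z^-1 ^+ 2 * h + 0 * h^*) =
          z^-1 * z^-1 * (z + h)^-1 * (h * h).
  by field; rewrite zh0.
rewrite !cmodM !cmodV -[cmod h * cmod h]expr2 ler_wpM2r ?sqr_ge0 //.
rewrite exprSr mulrCA -expr2 ler_wpM2l ?exprn_ge0 ?invr_ge0 ?cmod_ge0 //.
have -> : 2 * (cmod z)^-1 = (cmod z / 2)^-1 by rewrite invf_div mulrC.
by rewrite lef_pV2 // posrE; lra.
Qed.

Lemma rdiff_div f g z a a' : g z != 0 -> rdiff f z a 0 -> rdiff g z a' 0 ->
  rdiff (fun s => f s / g s) z ((a * g z - f z * a') / g z ^+ 2) 0.
Proof.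
move=> gz0 fo go.
have := rdiffM fo (rdiff_comp (rdiffV gz0) go).
rewrite /= !mulr0 mul0r addr0.
by set A := a / _ + _; have -> : A = (a * g z - f z * a') / g z ^+ 2
  by rewrite /A; field.
Qed.

End RealDifferentiability.

(** * Real differentiability and Wirtinger derivatives *)
Section Wirtinger.
Local Open Scope classical_set_scope.
Variable R : realType.
Local Notation C := R[i].
Implicit Types (f g : C -> C) (z a b c : C).

Lemma derivable_dist (K : numFieldType) (V W : normedModType K) (f : V -> W)
    (a v : V) :
  derivable f a v -> forall e, 0 < e ->
  \forall h \near 0^', `|'D_v f a - h^-1 *: (f (h *: v + a) - f a)| <= e.
Proof. by move=> /cvgrPdist_le. Qed.

Lemma derivable_rdiff f z : derivable (f : C^o -> C^o) z 1 ->
  rdiff f z (cderiv f z) 0.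
Proof.
move=> fz; have := @derivable_dist C C^o C^o f z 1 fz.
rewrite -derive1E -/(cderiv f z); move: (cderiv f z : C) => D H.
move=> e e0; have e0' : 0 < Complex e 0 by rewrite ltcR.
have [d /= d0 {}H] := H _ e0'.
have [dI dR] : complex.Im d = 0 /\ 0 < complex.Re d.
  by move: d0; rewrite ltcE /= => /andP[/eqP].
exists (complex.Re d) => // h hd.
have [->|h0] := eqVneq h 0.
  rewrite addr0 subrr conjC0 !mulr0 addr0 subr0 cmod0 mulr0 //.
have hb : ball (0 : C^o) d h.
  rewrite /ball /= sub0r normrN normE ltcE /= dI eqxx /= //.
have := H h hb h0; rewrite normE lecR.
have -> : (h *: (1 : C^o) + z) = z + h by rewrite -[h *: _]/(h * 1) mulr1 addrC.
rewrite -[h^-1 *: _]/(h^-1 * _) => H1.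
have -> : f (z + h) - f z - (D * h + 0 * h^*) =
  - (D - h^-1 * (f (z + h) - f z)) * h by field.
by rewrite cmodM cmodN ler_wpM2r ?cmod_ge0.
Qed.

Lemma derive1_little_o (phi : R -> R) (l : R) :
  (forall e : R, 0 < e -> exists2 d : R, 0 < d &
    forall s, `|s| < d -> `|phi s - phi 0 - l * s| <= e * `|s|) ->
  derivable phi 0 1 /\ derive1 phi 0 = l.
Proof.
move=> H.
have lim_l : h^-1 *: (phi (h *: 1 + 0) - phi 0) @[h --> 0^'] --> l.
  apply/cvgrPdist_le => e /H[d d0 {}H]; exists d => //= h.
  rewrite /ball /= sub0r normrN => hd h0; rewrite addr0 -![_ *: _]/(_ * _) mulr1.
  have -> : l - h^-1 * (phi h - phi 0) = - (phi h - phi 0 - l * h) / h by field.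
  by rewrite normrM normrN normfV ler_pdivrMr ?normr_gt0 // H.
suff : is_derive (0 : R) 1 phi l.
  by move=> D; split => //; rewrite derive1E derive_val.
by apply: DeriveDef; [exact: cvgP lim_l | exact: cvg_lim lim_l].
Qed.

(** The partial derivatives in the real and in the imaginary direction, of the
real and of the imaginary part, are four instances of the same statement:
[proj] is the part and [u] the unit direction. *)
Lemma rdiff_line f z a b u : rdiff f z a b ->
  forall (proj : C -> R), (forall x, `|proj x| <= cmod x) ->
  (forall x y, proj (x - y) = proj x - proj y) ->
  (forall x (s : R), proj (x * Complex s 0) = proj x * s) -> forall l : R -> C,
  (forall s, l s = u * Complex s 0) -> cmod u = 1 ->
  derivable (fun s : R => proj (f (z + l s))) 0 1 /\
  derive1 (fun s : R => proj (f (z + l s))) 0 = proj (a * u + b * u^*).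
Proof.
move=> fo proj proj_le projB projZ l lE u1.
apply: derive1_little_o => e /fo[d d0 H]; exists d => // s sd.
have ls : cmod (l s) = `|s| by rewrite lE cmodM u1 mul1r cmod_real.
have l0 : l 0 = 0 by rewrite lE mulr0.
have := H (l s); rewrite ls => /(_ sd); apply: le_trans.
apply: le_trans (proj_le _); rewrite l0 addr0 -projZ -!projB lE.
have -> : (u * Complex s 0)^* = u^* * Complex s 0.
  by rewrite rmorphM /=; congr (_ * _); apply/eqP; rewrite eq_complex /= oppr0 !eqxx.
by rewrite mulrDl !mulrA.
Qed.

Lemma rdiff_wirtinger f z a b : rdiff f z a b ->
  [/\ wirtinger_derivable f z, dw f z = a & dwbar f z = b].
Proof.
move=> fo.
have ReB x y : complex.Re (x - y : C) = complex.Re x - complex.Re y.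
  by case: x y => ? ? [? ?].
have ImB x y : complex.Im (x - y : C) = complex.Im x - complex.Im y.
  by case: x y => ? ? [? ?].
have ReZ x (s : R) : complex.Re (x * Complex s 0 : C) = complex.Re x * s.
  by case: x => ? ? /=; rewrite mulr0 subr0.
have ImZ x (s : R) : complex.Im (x * Complex s 0 : C) = complex.Im x * s.
  by case: x => ? ? /=; rewrite mulr0 add0r.
have lR (s : R) : Complex s 0 = 1 * Complex s 0 by rewrite mul1r.
have lI (s : R) : Complex 0 s = 'i%C * Complex s 0.
  by apply/eqP; rewrite eq_complex /= !(mul0r, mulr0, mul1r) subr0 add0r !eqxx.
have c1 : cmod (1 : C) = 1 by rewrite cmod_real normr1.
have [D1 E1] := rdiff_line fo (@ge_Re_cmod R) ReB ReZ lR c1.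
have [D2 E2] := rdiff_line fo (@ge_Im_cmod R) ImB ImZ lR c1.
have [D3 E3] := rdiff_line fo (@ge_Re_cmod R) ReB ReZ lI (cmod_i R).
have [D4 E4] := rdiff_line fo (@ge_Im_cmod R) ImB ImZ lI (cmod_i R).
have iJ : ('i%C : C)^* = - 'i%C by apply/eqP; rewrite eq_complex /= oppr0 !eqxx.
have duE : du f z = a + b.
  by rewrite /du E1 E2 conjC1 !mulr1; case: (a + b).
have dvE : dv f z = 'i%C * (a - b).
  rewrite /dv E3 E4 iJ; have -> : 'i%C * (a - b) = a * 'i%C + b * - 'i%C by ring.
  by case: (_ + _).
have ii : 'i%C * 'i%C = -1 :> C by rewrite -expr2 sqr_i.
split; first by split.
  by rewrite /dw duE dvE mulrA ii; field.
by rewrite /dwbar duE dvE mulrA ii; field.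
Qed.

(** The coefficients are determined by the function because they are its Wirtinger
derivatives. *)
Lemma rdiff_unique f z a b a' b' : rdiff f z a b -> rdiff f z a' b' -> a = a'.
Proof. by move=> /rdiff_wirtinger[_ <- _] /rdiff_wirtinger[_ <- _]. Qed.

Lemma open_cmod (D : set C) z : open (D : set C^o) -> D z ->
  exists2 d : R, 0 < d & forall h, cmod h < d -> D (z + h).
Proof.
rewrite openE => oD /oD /nbhs_ballP[d /= d0 H].
have [dI dR] : complex.Im d = 0 /\ 0 < complex.Re d.
  by move: d0; rewrite ltcE /= => /andP[/eqP].
exists (complex.Re d) => // h hd; apply: H.
rewrite /ball /=; have -> : z - (z + h) = - h by ring.
by rewrite normrN normE ltcE /= dI eqxx.
Qed.

End Wirtinger.

(** * A mean along an ultrafilter *)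
Section UltrafilterLimit.
Variable R : realType.
Local Notation C := R[i].
Local Open Scope classical_set_scope.

(** A fixed free ultrafilter on [nat]: along it every bounded sequence converges,
so that limits may be taken without any convergence proof. *)
Definition nat_ultrafilter : set_system nat :=
  projT1 (cid (ultraFilterLemma eventually_filter)).

Local Notation U := nat_ultrafilter.

Lemma nat_ultrafilter_ultra : UltraFilter U.
Proof. by rewrite /U; case: cid => ? [] /=. Qed.

#[local] Instance nat_ultrafilter_proper : ProperFilter U.
Proof. exact: (ultra_proper (UltraFilter := nat_ultrafilter_ultra)). Qed.

Lemma sub_nat_ultrafilter : \oo `<=` U.
Proof. by rewrite /U; case: cid => ? [] /=. Qed.

Definition real_ulim (s : nat -> R) : R := lim (s @ U).

Lemma real_ulimP (s : nat -> R) (m : R) : (forall n, `|s n| <= m) ->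
  s @ U --> real_ulim s.
Proof.
move=> sm; have sU : U (s @^-1` `[- m, m]).
  by apply: filterE => n /=; rewrite in_itv /= -ler_norml.
have [p [_ pcl]] := @segment_compact R (- m) m (s @ U) _ sU.
apply: (cvgP p) => A pA.
have [//|nA] := in_ultra_setVsetC (s @^-1` A) nat_ultrafilter_ultra.
by have [x []] := pcl _ _ (nA : (s @ U) (~` A)) pA.
Qed.

Lemma real_ulim_unique (s t : nat -> R) l : t @ U --> l -> s =1 t ->
  real_ulim s = l.
Proof. by move=> tl /funext ->; exact: cvg_lim tl. Qed.

(** The error term [k / (n + 1)] disappears in the limit since the ultrafilter
contains all cofinite sets. *)
Lemma real_ulim_le (s : nat -> R) (m b k : R) : (forall n, `|s n| <= m) ->
  (forall n, `|s n| <= b + k * n.+1%:R^-1) -> `|real_ulim s| <= b.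
Proof.
move=> sm sb; have sl := real_ulimP sm.
have bl : (fun n => b + k * n.+1%:R^-1) @ U --> b.
  rewrite -[X in _ --> X]addr0 -(mulr0 k).
  apply: cvgD; first exact: cvg_cst.
  apply: cvgMl_tmp; apply: cvg_trans cvg_harmonic.
  exact: cvg_app sub_nat_ultrafilter.
apply: ler_cvg_to (cvg_norm sl) bl _.
by apply: filterE => n; exact: sb.
Qed.

Definition ulim (s : nat -> C) : C :=
  Complex (real_ulim (fun n => complex.Re (s n)))
          (real_ulim (fun n => complex.Im (s n))).

(** The factor [2] comes from estimating real and imaginary part separately. *)
Lemma ulim_le (s : nat -> C) (m b k : R) : (forall n, cmod (s n) <= m) ->
  (forall n, cmod (s n) <= b + k * n.+1%:R^-1) -> cmod (ulim s) <= 2 * b.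
Proof.
move=> sm sb; apply: (le_trans (cmod_le_ReIm _)) => /=.
rewrite mulr_natl mulr2n; apply: lerD; apply: (@real_ulim_le _ m b k) => n.
- exact: le_trans (ge_Re_cmod _) (sm n).
- exact: le_trans (ge_Re_cmod _) (sb n).
- exact: le_trans (ge_Im_cmod _) (sm n).
- exact: le_trans (ge_Im_cmod _) (sb n).
Qed.

Lemma ulim_linear (s s' : nat -> C) (m m' : R) c :
  (forall n, cmod (s n) <= m) -> (forall n, cmod (s' n) <= m') ->
  ulim (fun n => s n + c * s' n) = ulim s + c * ulim s'.
Proof.
move=> sm sm'.
have r1 := real_ulimP (fun n => le_trans (ge_Re_cmod _) (sm n)).
have i1 := real_ulimP (fun n => le_trans (ge_Im_cmod _) (sm n)).
have r2 := real_ulimP (fun n => le_trans (ge_Re_cmod _) (sm' n)).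
have i2 := real_ulimP (fun n => le_trans (ge_Im_cmod _) (sm' n)).
have ReE (x y : C) : complex.Re (x + c * y) = complex.Re x
    + (complex.Re c * complex.Re y - complex.Im c * complex.Im y).
  by case: (c) x y => ? ? [? ?] [? ?].
have ImE (x y : C) : complex.Im (x + c * y) = complex.Im x
    + (complex.Re c * complex.Im y + complex.Im c * complex.Re y).
  by case: (c) x y => ? ? [? ?] [? ?].
apply/eqP; rewrite eq_complex; apply/andP; split; apply/eqP.
  rewrite ReE; apply: real_ulim_unique (cvgD r1
    (cvgB (cvgMl_tmp (a := complex.Re c) r2) (cvgMl_tmp (a := complex.Im c) i2))) _.
  by move=> n; exact: ReE.
rewrite ImE; apply: real_ulim_unique (cvgD i1
  (cvgD (cvgMl_tmp (a := complex.Re c) i2) (cvgMl_tmp (a := complex.Im c) r2))) _.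
by move=> n; exact: ImE.
Qed.

Lemma ulim_cst c : ulim (fun=> c) = c.
Proof.
by case: c => a b; congr Complex; by apply: real_ulim_unique; [exact: cvg_cst|].
Qed.

End UltrafilterLimit.

(** * Integration of bounded functions over intervals *)
Section Mean.
Variable R : realType.
Local Notation C := R[i].
Implicit Types (phi psi : R -> C) (x : R) (c : C).

Definition unit_bounded phi :=
  exists m : R, forall t, 0 <= t <= 1 -> cmod (phi t) <= m.

(** The Riemann sum over [[0, x]] on the grid of mesh [1 / (n + 1)].  Sampling at
right end points keeps all sample points of a difference
[riemann_sum n b phi - riemann_sum n a phi] inside [[a, b]]. *)
Definition riemann_sum n x phi : C :=
  n.+1%:R^-1 * \sum_(0 <= k < Num.truncn (x * n.+1%:R)) phi (k.+1%:R / n.+1%:R).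

(** For continuous functions this is the integral over [[0, x]].  Differences
[prefix_integral b phi - prefix_integral a phi] play the role of integrals over
[[a, b]], which makes additivity in the interval an algebraic identity. *)
Definition prefix_integral x phi : C := ulim (fun n => riemann_sum n x phi).

Lemma natr_complex n : Complex n%:R 0 = n%:R :> C.
Proof. by rewrite -[LHS]/(real_complex R n%:R) rmorph_nat. Qed.

Lemma cmod_nat n : cmod (n%:R : C) = n%:R.
Proof. by rewrite -natr_complex cmod_real normr_nat. Qed.

Lemma cmod_sum_nat (a b : nat) (F : nat -> C) (e : R) :
  (forall k, (a <= k < b)%N -> cmod (F k) <= e) ->
  cmod (\sum_(a <= k < b) F k) <= (b - a)%:R * e.
Proof.
move=> Fe; have := ler_sum_nat Fe; rewrite sumr_const_nat mulr_natl.
apply: le_trans; elim/big_rec2: _ => [|k x y _ xy]; first by rewrite cmod0.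
by apply: (le_trans (cmodD _ _)); rewrite lerD2l.
Qed.

(** The number of grid points in an interval differs from [(b - a) * (n + 1)] by at
most one, which accounts for the term in [1 / (n + 1)]. *)
Lemma riemann_sum_close n (a b e : R) phi c : 0 <= a <= b -> b <= 1 ->
  (forall t, a <= t <= b -> cmod (phi t - c) <= e) ->
  cmod (riemann_sum n b phi - riemann_sum n a phi - c * Complex (b - a) 0)
    <= e * (b - a) + (e + cmod c) * n.+1%:R^-1.
Proof.
move=> /andP[a0 ab] b1 H.
have e0 : 0 <= e by apply: le_trans (H a _); rewrite ?cmod_ge0 ?lexx.
have N0 : 0 < n.+1%:R :> R by rewrite ltr0n.
have b0 : 0 <= b by lra.
have /andP[p1 p2] := truncn_itv (mulr_ge0 a0 (ltW N0)).
have /andP[q1 q2] := truncn_itv (mulr_ge0 b0 (ltW N0)).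
rewrite /riemann_sum.
move: (Num.truncn (a * _)) (Num.truncn (b * _)) p1 p2 q1 q2 => p q p1 p2 q1 q2.
have pq : (p <= q)%N.
  rewrite -ltnS -(ltr_nat R); apply: le_lt_trans p1 _; apply: le_lt_trans _ q2.
  by rewrite ler_wpM2r // ltW.
rewrite (big_cat_nat (leq0n p) pq) /= mulrDr [_ + _ - n.+1%:R^-1 * _]addrC addKr.
have N0' : n.+1%:R != 0 :> C by rewrite pnatr_eq0.
have -> : Complex (b - a) 0 = n.+1%:R^-1 * Complex ((b - a) * n.+1%:R) 0.
  have -> : Complex ((b - a) * n.+1%:R) 0 = Complex (b - a) 0 * n.+1%:R.
    rewrite -natr_complex; apply/eqP.
    by rewrite eq_complex /= !(mulr0, mul0r) subr0 addr0 !eqxx.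
  by rewrite mulrC mulfK.
have -> : \sum_(p <= k < q) phi (k.+1%:R / n.+1%:R) =
  \sum_(p <= k < q) (phi (k.+1%:R / n.+1%:R) - c) + c * (q - p)%:R.
  by rewrite sumrB sumr_const_nat mulr_natr subrK.
set S := \sum_(_ <= _ < _) _.
have S_le : cmod S <= (q - p)%:R * e.
  apply: cmod_sum_nat => k /andP[pk kq]; apply: H; apply/andP; split.
    rewrite ler_pdivlMr //; apply: le_trans (ltW p2) _; rewrite ler_nat ltnS //.
  rewrite ler_pdivrMr //; apply: le_trans _ q1; rewrite ler_nat //.
have -> : n.+1%:R^-1 * (S + c * (q - p)%:R) -
  c * (n.+1%:R^-1 * Complex ((b - a) * n.+1%:R) 0) =
  n.+1%:R^-1 * (S + c * ((q - p)%:R - Complex ((b - a) * n.+1%:R) 0)) by ring.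
rewrite cmodM cmodV cmod_nat mulrC ler_pdivrMr //.
have -> : (e * (b - a) + (e + cmod c) * n.+1%:R^-1) * n.+1%:R =
  e * (b - a) * n.+1%:R + (e + cmod c) by field; rewrite gt_eqF.
have -> : (q - p)%:R - Complex ((b - a) * n.+1%:R) 0 =
    Complex ((q - p)%:R - (b - a) * n.+1%:R) 0.
  by rewrite -natr_complex; apply/eqP; rewrite eq_complex /= subr0 !eqxx.
apply: (le_trans (cmodD _ _)); rewrite cmodM cmod_real.
have c0 := cmod_ge0 c.
move: S_le; rewrite natrB // => S_le.
have D : `|q%:R - p%:R - (b - a) * n.+1%:R| <= 1 by rewrite ler_norml; lra.
by have := cmod_ge0 S; nra.
Qed.

Lemma riemann_sum_le n x phi (m : R) : 0 <= x <= 1 ->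
  (forall t, 0 <= t <= 1 -> cmod (phi t) <= m) ->
  cmod (riemann_sum n x phi) <= m + m.
Proof.
move=> /andP[x0 x1] H.
have m0 : 0 <= m by apply: le_trans (H 0 _); rewrite ?cmod_ge0 ?lexx ?ler01.
have H0 t : 0 <= t <= x -> cmod (phi t - 0) <= m.
  by move=> /andP[t0 tx]; rewrite subr0 H // t0 (le_trans tx).
have := @riemann_sum_close n 0 x m phi 0; rewrite lexx x0 => /(_ isT x1 H0).
rewrite {2}/riemann_sum !mul0r truncn0 big_geq // mulr0 !subr0 cmod0 addr0.
move=> /le_trans; apply; apply: lerD; first by rewrite ler_piMr.
by rewrite ler_piMr // invf_le1 ?ler1n // ltr0n.
Qed.

Lemma prefix_integral_linear x phi psi c : 0 <= x <= 1 ->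
  unit_bounded phi -> unit_bounded psi ->
  prefix_integral x (fun t => phi t + c * psi t) =
  prefix_integral x phi + c * prefix_integral x psi.
Proof.
move=> x01 [m phi_m] [m' psi_m]; rewrite /prefix_integral.
rewrite -(ulim_linear c (fun n => riemann_sum_le n x01 phi_m)
                        (fun n => riemann_sum_le n x01 psi_m)).
congr ulim; apply/funext => n.
by rewrite /riemann_sum big_split /= -mulr_sumr mulrDr mulrCA.
Qed.

(** A function close to a constant has an integral close to that of the constant.
This single estimate gives all bounds on integrals below, including, with
[c = 0], the bound by the supremum. *)
Lemma prefix_integral_close (a b e : R) phi c : 0 <= a <= b -> b <= 1 ->
  unit_bounded phi -> (forall t, a <= t <= b -> cmod (phi t - c) <= e) ->
  cmod (prefix_integral b phi - prefix_integral a phi - c * Complex (b - a) 0)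
    <= 2 * (e * (b - a)).
Proof.
move=> ab b1 [m phi_m] H; have /andP[a0 ab'] := ab.
have Sb n : cmod (riemann_sum n b phi) <= m + m.
  by apply: riemann_sum_le phi_m; rewrite b1 (le_trans a0).
have Sa n : cmod (riemann_sum n a phi) <= m + m.
  by apply: riemann_sum_le phi_m; rewrite a0 (le_trans ab').
have Sc n := riemann_sum_close n ab b1 H.
have Sab n : cmod (riemann_sum n b phi + (-1) * riemann_sum n a phi)
    <= m + m + (m + m).
  rewrite mulN1r; apply: (le_trans (cmodB _ _)); exact: lerD.
set k := c * _ in Sc *.
have -> : prefix_integral b phi - prefix_integral a phi - k = ulim (fun n =>
    (riemann_sum n b phi + (-1) * riemann_sum n a phi) + (-1) * k).
  have kk (n : nat) : cmod k <= cmod k by [].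
  rewrite (ulim_linear _ Sab kk) (ulim_linear _ Sb Sa) ulim_cst.
  by rewrite !mulN1r.
apply: (@ulim_le _ _ (m + m + (m + m) + cmod k) _ (e + cmod c)) => n.
  by rewrite [-1 * k]mulN1r; apply: (le_trans (cmodB _ _)); rewrite lerD2r.
by rewrite !mulN1r.
Qed.

End Mean.

(** * Bisection of squares *)
Section Bisection.
Variable R : realType.

Lemma nested_segments (u v : nat -> R) : (forall n, u n <= u n.+1) ->
  (forall n, v n.+1 <= v n) -> (forall n, u n <= v n) ->
  exists p, forall n, u n <= p <= v n.
Proof.
move=> ui vd uv.
have uM : {homo u : m n / (m <= n)%N >-> m <= n} by exact: homo_leq lexx le_trans ui.
have vM m n : (m <= n)%N -> v n <= v m.
  move=> mn; rewrite -lerN2.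
  apply: (homo_leq (f := fun n => - v n) lexx le_trans) mn => k; rewrite lerN2 //.
have uv' m n : u m <= v n.
  apply: le_trans (uM _ _ (leq_maxl m n)) _; apply: le_trans (uv _) _.
  exact: vM (leq_maxr _ _).
have us : has_sup (range u).
  by split; [exists (u 0%N), 0%N | exists (v 0%N) => _ [m _ <-]].
exists (sup (range u)) => n; apply/andP; split.
  by apply: ub_le_sup; [exact: us.2 | exists n].
by apply: ge_sup; [exact: us.1 | move=> _ [m _ <-]].
Qed.

Lemma exp2N_lt (d : R) : 0 < d -> exists n, 2^-1 ^+ n < d :> R.
Proof.
move=> d0; exists (Num.truncn d^-1).+1.
have d1 : 0 < d^-1 by rewrite invr_gt0.
have /andP[_ dn] := truncn_itv (ltW d1).
move: (Num.truncn _).+1 dn => n dn.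
rewrite exprVn invf_plt ?posrE ?exprn_gt0 //; apply: (lt_trans dn).
by rewrite -natrX ltr_nat ltn_expl.
Qed.

(** If a property of squares passes from a square to one of its four quarters,
repeated bisection produces a point all of whose neighborhoods contain a square
with the property that contains the point. *)
Lemma square_bisection (bad : R -> R -> R -> Prop) : bad 0 0 1 ->
  (forall x y s, 0 <= x -> x + s <= 1 -> 0 <= y -> y + s <= 1 -> 0 < s ->
     bad x y s -> exists a b : bool,
     bad (x + a%:R * (s / 2)) (y + b%:R * (s / 2)) (s / 2)) ->
  exists px py : R, forall d : R, 0 < d -> exists x y s,
    [/\ 0 < s < d, 0 <= x /\ x + s <= 1, 0 <= y /\ y + s <= 1,
        x <= px <= x + s /\ y <= py <= y + s & bad x y s].
Proof.
move=> bad0 split4; pose h n : R := 2^-1 ^+ n.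
have h_gt0 n : 0 < h n by rewrite exprn_gt0 // invr_gt0.
have hS n : h n.+1 = h n / 2 by rewrite /h exprSr.
pose good_sq n (p : R * R) := [/\ 0 <= p.1 /\ p.1 + h n <= 1,
  0 <= p.2 /\ p.2 + h n <= 1 & bad p.1 p.2 (h n)].
(* A state is the number of bisections together with the lower left corner. *)
have /choice[f fP] : forall np : nat * (R * R), exists q : R * R,
    good_sq np.1 np.2 -> [/\ good_sq np.1.+1 q,
      np.2.1 <= q.1 /\ q.1 + h np.1.+1 <= np.2.1 + h np.1 &
      np.2.2 <= q.2 /\ q.2 + h np.1.+1 <= np.2.2 + h np.1].
  case=> n [x y] /=.
  have [[[x0 x1] [y0 y1] b]|nb] := pselect (good_sq n (x, y)); last first.
    by exists (0, 0) => /nb.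
  have [a [c bc]] := split4 _ _ _ x0 x1 y0 y1 (h_gt0 n) b.
  exists (x + a%:R * (h n / 2), y + c%:R * (h n / 2)) => _.
  have := h_gt0 n; rewrite /good_sq /= hS /= in x0 x1 y0 y1 *.
  by case: a c bc => -[] /= bc h0; split; try split=> //; try lra.
pose sq := fix sq n := match n with 0%N => (0, 0) | m.+1 => f (m, sq m) end.
have sqP n : good_sq n (sq n).
  elim: n => [|n IH]; first by split; rewrite /= ?add0r /h ?expr0 ?lexx.
  by have [] := fP (n, sq n) IH.
have sq1 n : (sq n).1 <= (sq n.+1).1 /\ (sq n.+1).1 + h n.+1 <= (sq n).1 + h n.
  by have [] := fP (n, sq n) (sqP n).
have sq2 n : (sq n).2 <= (sq n.+1).2 /\ (sq n.+1).2 + h n.+1 <= (sq n).2 + h n.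
  by have [] := fP (n, sq n) (sqP n).
have leh (x : R) n : x <= x + h n by rewrite lerDl ltW.
have [px Px] := nested_segments (fun n => (sq1 n).1) (fun n => (sq1 n).2)
  (fun n => leh (sq n).1 n).
have [py Py] := nested_segments (fun n => (sq2 n).1) (fun n => (sq2 n).2)
  (fun n => leh (sq n).2 n).
exists px, py => d /exp2N_lt[n nd]; exists (sq n).1, (sq n).2, (h n).
by have [? ? ?] := sqP n; split; rewrite ?h_gt0.
Qed.

End Bisection.

(** * Goursat's theorem with an exceptional point *)
Section Goursat.
Variable R : realType.
Local Notation C := R[i].
Implicit Types (G : C -> C) (x y s : R).

(** The contour integral of [G] along the boundary of the square with lower left
corner [x + i y] and side [s], counterclockwise. *)
Definition square_integral G x y s : C :=
  let bottom t := G (Complex t y) in let top t := G (Complex t (y + s)) in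
  let left t := G (Complex x t) in let right t := G (Complex (x + s) t) in
  (prefix_integral (x + s) bottom - prefix_integral x bottom)
  - (prefix_integral (x + s) top - prefix_integral x top)
  + 'i%C * ((prefix_integral (y + s) right - prefix_integral y right)
            - (prefix_integral (y + s) left - prefix_integral y left)).

Definition square_bounded G (m : R) :=
  forall x y, 0 <= x <= 1 -> 0 <= y <= 1 -> cmod (G (Complex x y)) <= m.

(** The inner sides cancel; with differences of [prefix_integral] this is an
identity in the ring, valid for every [G]. *)
Lemma square_integral_split G x y s : square_integral G x y s =
  square_integral G x y (s / 2) + square_integral G (x + s / 2) y (s / 2)
  + square_integral G x (y + s / 2) (s / 2)
  + square_integral G (x + s / 2) (y + s / 2) (s / 2).
Proof.
have hs u : u + s / 2 + s / 2 = u + s :> R by field.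
by rewrite /square_integral !hs; ring.
Qed.

(** Opposite sides are compared: if the difference of [G] across the square is
close to that of the linear function of slope [c], whose contour integral
vanishes, then the contour integral is small. *)
Lemma square_integral_close G (m e : R) (c : C) x y s : square_bounded G m ->
  0 <= x -> x + s <= 1 -> 0 <= y -> y + s <= 1 -> 0 < s ->
  (forall t, x <= t <= x + s -> cmod (G (Complex t y) - G (Complex t (y + s))
     + c * 'i%C * Complex s 0) <= e) ->
  (forall t, y <= t <= y + s -> cmod (G (Complex (x + s) t) - G (Complex x t)
     - c * Complex s 0) <= e) ->
  cmod (square_integral G x y s) <= 4 * (e * s).
Proof.
move=> Gm x0 xs1 y0 ys1 s0 Hx Hy.
have y01 : 0 <= y <= 1 by lra.
have ys01 : 0 <= y + s <= 1 by lra.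
have x01 : 0 <= x <= 1 by lra.
have xs01 : 0 <= x + s <= 1 by lra.
have bnd_h u : 0 <= u <= 1 -> unit_bounded (fun t => G (Complex t u)).
  by move=> u01; exists m => t t01; exact: Gm.
have bnd_v u : 0 <= u <= 1 -> unit_bounded (fun t => G (Complex u t)).
  by move=> u01; exists m => t t01; exact: Gm.
have bnd2 (phi psi : R -> C) : unit_bounded phi -> unit_bounded psi ->
    unit_bounded (fun t => phi t + (-1) * psi t).
  move=> [k1 H1] [k2 H2]; exists (k1 + k2) => t t01.
  by rewrite mulN1r; apply: (le_trans (cmodB _ _)); rewrite lerD ?H1 ?H2.
have HB := prefix_integral_close (c := - (c * 'i%C * Complex s 0)) (e := e)
  (a := x) (b := x + s) _ xs1 (bnd2 _ _ (bnd_h _ y01) (bnd_h _ ys01)).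
have VB := prefix_integral_close (c := c * Complex s 0) (e := e)
  (a := y) (b := y + s) _ ys1 (bnd2 _ _ (bnd_v _ xs01) (bnd_v _ x01)).
rewrite !prefix_integral_linear ?[_ + s - _]addrAC ?subrr ?add0r in HB VB;
  try by [|exact: bnd_h | exact: bnd_v].
have {}HB := HB ltac:(lra); have {}VB := VB ltac:(lra).
set H := (X in cmod X <= _) in HB; set V := (X in cmod X <= _) in VB.
have -> : square_integral G x y s = H + 'i%C * V.
  by rewrite /square_integral /H /V; ring.
have {}HB : cmod H <= 2 * (e * s).
  apply: HB => t tx; have := Hx t tx.
  by rewrite mulN1r opprK.
have {}VB : cmod V <= 2 * (e * s).
  apply: VB => t ty; have := Hy t ty.
  by rewrite mulN1r.
by have := cmodD H ('i%C * V); rewrite cmodM cmod_i mul1r; lra.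
Qed.

Lemma cmod_square (x y s x' y' : R) : x <= x' <= x + s -> y <= y' <= y + s ->
  forall u v, x <= u <= x + s -> y <= v <= y + s ->
  cmod (Complex u v - Complex x' y') <= 2 * s.
Proof.
move=> xx yy u v ux vy; apply: (le_trans (cmod_le_ReIm _)) => /=.
have : `|u - x'| <= s by rewrite ler_norml; lra.
have : `|v - y'| <= s by rewrite ler_norml; lra.
lra.
Qed.

(** Near a point of differentiability [G] is linear up to [o(s)] on a square of
side [s], so the contour integral is small compared to the area. *)
Lemma square_integral_differentiable G (m e : R) a (px py : R) :
  square_bounded G m -> rdiff G (Complex px py) a 0 -> 0 < e ->
  exists2 d : R, 0 < d & forall x y s, 0 < s < d -> 0 <= x /\ x + s <= 1 ->
    0 <= y /\ y + s <= 1 -> x <= px <= x + s -> y <= py <= y + s ->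
    cmod (square_integral G x y s) <= e * s ^+ 2.
Proof.
move=> Gm Ga e0; have e'0 : 0 < e / 16 by lra.
have [d d0 H] := Ga _ e'0; exists (d / 2); first by lra.
move=> x y s /andP[s0 sd] [x0 x1] [y0 y1] xx yy.
have {}H u v : x <= u <= x + s -> y <= v <= y + s ->
  cmod (G (Complex u v) - G (Complex px py) - a * (Complex u v - Complex px py))
    <= e / 16 * (2 * s).
  move=> ux vy; have D := cmod_square xx yy ux vy.
  have := H (Complex u v - Complex px py).
  rewrite mul0r addr0 [Complex px py + _]addrC subrK.
  move=> {}H; apply: le_trans (H _) _; first by lra.
  by rewrite ler_wpM2l // ltW.
have -> : e * s ^+ 2 = 4 * (e / 8 * (2 * s) * s) by field.
have lx : x <= x <= x + s by lra.
have rx : x <= x + s <= x + s by lra.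
have ly : y <= y <= y + s by lra.
have ry : y <= y + s <= y + s by lra.
apply: (square_integral_close (c := a) Gm) => // t tx.
  set A := (X in cmod X).
  have -> : A =
    (G (Complex t y) - G (Complex px py) - a * (Complex t y - Complex px py))
    - (G (Complex t (y + s)) - G (Complex px py)
       - a * (Complex t (y + s) - Complex px py)).
    rewrite /A; have -> : Complex t (y + s) = Complex t y + 'i%C * Complex s 0.
      apply/eqP; rewrite eq_complex /=.
      by rewrite !(mul0r, mulr0, mul1r, subr0, addr0, add0r) !eqxx.
    ring.
  apply: (le_trans (cmodB _ _)); have := H t y tx ly; have := H t _ tx ry; lra.
set A := (X in cmod X).
have -> : A = (G (Complex (x + s) t) - G (Complex px py)
       - a * (Complex (x + s) t - Complex px py))
    - (G (Complex x t) - G (Complex px py) - a * (Complex x t - Complex px py)).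
  rewrite /A; have -> : Complex (x + s) t = Complex x t + Complex s 0.
    by apply/eqP; rewrite eq_complex /= addr0 !eqxx.
  ring.
apply: (le_trans (cmodB _ _)); have := H x t lx tx; have := H _ t rx tx; lra.
Qed.

Lemma square_integral_bounded G (m : R) x y s : square_bounded G m ->
  0 <= x /\ x + s <= 1 -> 0 <= y /\ y + s <= 1 -> 0 < s ->
  cmod (square_integral G x y s) <= 8 * (m * s).
Proof.
move=> Gm [x0 x1] [y0 y1] s0.
have -> : 8 * (m * s) = 4 * ((m + m) * s) by ring.
apply: (square_integral_close (c := 0) Gm) => // t tx; rewrite !mul0r ?addr0 ?subr0;
  apply: (le_trans (cmodB _ _)); apply: lerD; apply: Gm; lra.
Qed.

(** Suppose the contour integral is nonzero and compare its modulus, which is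
subadditive under bisection, with the additive set function
[e * area + e * mass], where [mass] is carried by the exceptional point [z].  A
square on which the modulus is larger has a quarter with the same property, and
these quarters shrink to a point.  If that point is not [z], differentiability
makes the modulus smaller than [e * area]; if it is [z], boundedness makes it
smaller than [e], while squares containing [z] have mass at least [1]. *)
Theorem goursat_punctured G (m : R) (z : C) : square_bounded G m ->
  (forall x y, 0 <= x <= 1 -> 0 <= y <= 1 -> Complex x y != z ->
     exists a, rdiff G (Complex x y) a 0) ->
  square_integral G 0 0 1 = 0.
Proof.
move=> Gm Gd; apply/eqP; rewrite -cmod_eq0; apply: contraT => I0.
have {}I0 : 0 < cmod (square_integral G 0 0 1) by rewrite lt_def I0 cmod_ge0.
(* The unit square has area 1 and mass at most 4, so any factor below 1/5 makes
   it violate the bound. *)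
pose e := cmod (square_integral G 0 0 1) / 10.
have e0 : 0 < e by rewrite /e; lra.
(* The distribution function of a point mass at [p], counted from the left and
   from the right: so a closed interval with [p] as an end point has positive
   mass, and the mass remains additive. *)
pose jump (p t : R) : R := (p < t)%R%:R + (p <= t)%R%:R.
pose mass x y s := (jump (complex.Re z) (x + s) - jump (complex.Re z) x)
  * (jump (complex.Im z) (y + s) - jump (complex.Im z) y).
pose bad x y s := e * s ^+ 2 + e * mass x y s < cmod (square_integral G x y s).
have jump_le p t : 0 <= jump p t <= 2.
  by rewrite /jump; case: (p < t); case: (p <= t) => /=; lra.
have jump_mono p t s : 0 < s -> jump p t <= jump p (t + s).
  move=> s0; rewrite /jump; case: (ltP p t) => h1; case: (leP p t) => h2;
  case: (ltP p (t + s)) => h3; case: (leP p (t + s)) => h4 /=; lra.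
have jump_in p t s : 0 < s -> t <= p <= t + s -> 1 <= jump p (t + s) - jump p t.
  move=> s0 pt; rewrite /jump; case: (ltP p t) => h1; case: (leP p t) => h2;
  case: (ltP p (t + s)) => h3; case: (leP p (t + s)) => h4 /=; lra.
have bad0 : bad 0 0 1.
  have m4 : mass 0 0 1 <= 4.
    have prod4 (a b : R) : `|a| <= 2 -> `|b| <= 2 -> a * b <= 4.
      move=> a2 b2; apply: (le_trans (ler_norm _)); rewrite normrM.
      have -> : 4 = 2 * 2 :> R by ring.
      by apply: ler_pM.
    apply: prod4; rewrite ler_norml.
      have := jump_le (complex.Re z) 0; have := jump_le (complex.Re z) (0 + 1); lra.
    have := jump_le (complex.Im z) 0; have := jump_le (complex.Im z) (0 + 1); lra.
  have E10 : cmod (square_integral G 0 0 1) = 10 * e by rewrite /e; field.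
  have := ler_wpM2l (ltW e0) m4; rewrite /bad expr1n E10; lra.
have split4 x y s : 0 <= x -> x + s <= 1 -> 0 <= y -> y + s <= 1 -> 0 < s ->
    bad x y s -> exists a b : bool,
    bad (x + a%:R * (s / 2)) (y + b%:R * (s / 2)) (s / 2).
  move=> _ _ _ _ _ b; apply: contrapT => nb.
  have {}nb (u v : bool) :
      cmod (square_integral G (x + u%:R * (s / 2)) (y + v%:R * (s / 2)) (s / 2))
      <= e * (s / 2) ^+ 2
         + e * mass (x + u%:R * (s / 2)) (y + v%:R * (s / 2)) (s / 2).
    by rewrite leNgt; apply/negP => ?; apply: nb; exists u, v.
  have hs u : u + s / 2 + s / 2 = u + s :> R by field.
  have massE : mass x y s = mass x y (s / 2) + mass (x + s / 2) y (s / 2)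
      + mass x (y + s / 2) (s / 2) + mass (x + s / 2) (y + s / 2) (s / 2).
    by rewrite /mass !hs; ring.
  have areaE : e * s ^+ 2 = 4 * (e * (s / 2) ^+ 2) by field.
  move: (nb true true) (nb true false) (nb false true) (nb false false) b.
  rewrite /bad massE areaE !mul0r !addr0 !mul1r !mulrDr (square_integral_split G x y s).
  set I1 := square_integral G x y _; set I2 := square_integral G _ y _.
  set I3 := square_integral G x _ _; set I4 := square_integral _ _ _ _.
  have := cmodD (I1 + I2 + I3) I4; have := cmodD (I1 + I2) I3.
  have := cmodD I1 I2; lra.
have [px [py H]] := square_bisection bad0 split4.
have pxy : (0 <= px <= 1) /\ (0 <= py <= 1).
  by have [x [y [s [? [? ?] [? ?] [? ?] _]]]] := H 1 ltr01; lra.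
have [pz|pz] := eqVneq (Complex px py) z.
  have m0 : 0 <= m.
    by apply: le_trans (Gm 0 0 _ _); rewrite ?cmod_ge0 ?lexx ?ler01.
  have d0 : 0 < e / (8 * m + 1) by rewrite divr_gt0 //; lra.
  have [x [y [s [/andP[s0 sd] xs ys [xx yy]]]]] := H _ d0.
  rewrite /bad; have := square_integral_bounded Gm xs ys s0.
  move: sd; rewrite ltr_pdivlMr; last by lra.
  have := jump_in (complex.Re z) x s s0; have := jump_in (complex.Im z) y s s0.
  rewrite -pz /= => /(_ yy) j1 /(_ xx) j2.
  have : 1 <= mass x y s by rewrite /mass -pz /=; nra.
  move: (mass x y s) => M M1; nra.
have [a Ga] := Gd px py pxy.1 pxy.2 pz.
have [d d0 K] := square_integral_differentiable Gm Ga e0.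
have [x [y [s [s0 xs ys [xx yy]]]]] := H _ d0.
have := K x y s s0 xs ys xx yy; rewrite /bad.
have : 0 <= mass x y s.
  by rewrite /mass mulr_ge0 // subr_ge0; apply: jump_mono; case/andP: s0.
nra.
Qed.

End Goursat.

(** * Cauchy integrals are twice differentiable *)
Section CauchyTransform.
Variable R : realType.
Local Notation C := R[i].
Implicit Types (f u : C -> C) (phi : R -> C) (gamma : R -> C) (z : C).

Lemma prefix_integral0 phi : prefix_integral 0 phi = 0.
Proof.
rewrite /prefix_integral -[RHS](@ulim_cst R); congr ulim; apply/funext => n.
by rewrite /riemann_sum mul0r truncn0 big_geq // mulr0.
Qed.

Definition unit_integral phi : C := prefix_integral 1 phi.

Lemma unit_integral_linear phi (psi : R -> C) c :
  unit_bounded phi -> unit_bounded psi ->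
  unit_integral (fun t => phi t + c * psi t) =
  unit_integral phi + c * unit_integral psi.
Proof. by apply: prefix_integral_linear; rewrite lexx ler01. Qed.

Lemma unit_bounded_lin phi (psi : R -> C) c :
  unit_bounded phi -> unit_bounded psi ->
  unit_bounded (fun t => phi t + c * psi t).
Proof.
move=> [m Hm] [k Hk]; exists (m + cmod c * k) => t t01.
apply: (le_trans (cmodD _ _)); rewrite cmodM lerD ?Hm //.
by rewrite ler_wpM2l ?cmod_ge0 ?Hk.
Qed.

Lemma unit_integral_close phi c (e : R) : unit_bounded phi ->
  (forall t, 0 <= t <= 1 -> cmod (phi t - c) <= e) ->
  cmod (unit_integral phi - c) <= 2 * e.
Proof.
move=> phib H; have := @prefix_integral_close R 0 1 e phi c.
rewrite lexx ler01 prefix_integral0 !subr0 => /(_ isT (lexx _) phib H).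
by rewrite -[Complex 1 0]/(1 : C) !mulr1.
Qed.

(** Differentiation under the integral sign.  A second order bound that is uniform
in [t] replaces dominated convergence. *)
Lemma rdiff_unit_integral (kappa : C -> R -> C) (kappa' : R -> C) z (k d : R) :
  0 < d -> 0 <= k ->
  (forall h, cmod h < d -> unit_bounded (kappa (z + h))) ->
  unit_bounded kappa' ->
  (forall h t, cmod h < d -> 0 <= t <= 1 ->
     cmod (kappa (z + h) t - kappa z t - h * kappa' t) <= k * cmod h ^+ 2) ->
  rdiff (fun s => unit_integral (kappa s)) z (unit_integral kappa') 0.
Proof.
move=> d0 k0 kb k'b H; apply: (@little_o_quadratic _ _ (2 * k) d) => //; first by lra.
move=> h hd; have b1 := kb h hd.
have b0 : unit_bounded (kappa z) by have := kb 0; rewrite addr0 cmod0; exact.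
have -> : unit_integral (kappa (z + h)) - unit_integral (kappa z)
    - (unit_integral kappa' * h + 0 * h^*) =
  unit_integral (fun t => (kappa (z + h) t + (-1) * kappa z t) + (- h) * kappa' t).
  rewrite unit_integral_linear // ?unit_integral_linear //; first by ring.
  exact: unit_bounded_lin.
rewrite -[X in cmod X]subr0 -mulrA; apply: unit_integral_close.
  by do 2 apply: unit_bounded_lin => //.
by move=> t t01; rewrite subr0 mulN1r mulNr; exact: H.
Qed.

(** The first derivative has to exist on a neighborhood for the second one to make
sense at [z]. *)
Definition twice_diff f z := exists2 f' : C -> C,
  (exists2 d : R, 0 < d & forall h, cmod h < d -> rdiff f (z + h) (f' (z + h)) 0) &
  exists b, rdiff f' z b 0.

Lemma cmod_inv_le (w : C) (rho : R) : 0 < rho -> rho <= cmod w ->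
  cmod w^-1 <= rho^-1.
Proof. by move=> r0 rw; rewrite cmodV lef_pV2 // posrE //; apply: lt_le_trans rw. Qed.

Lemma cmodM_le (x y : C) (a b : R) : cmod x <= a -> cmod y <= b ->
  cmod (x * y) <= a * b.
Proof. by move=> xa yb; rewrite cmodM; apply: ler_pM => //; exact: cmod_ge0. Qed.

(** The derivatives are the integrals of [phi / (gamma - s) ^+ 2] and
[2 * phi / (gamma - s) ^+ 3]: only the kernel depends on the point, and it
is smooth at positive distance from the contour. *)
Lemma twice_diff_cauchy phi gamma z (rho : R) : 0 < rho -> unit_bounded phi ->
  (forall t, 0 <= t <= 1 -> rho <= cmod (gamma t - z)) ->
  twice_diff (fun s => unit_integral (fun t => phi t / (gamma t - s))) z.
Proof.
move=> rho0 [m Hm] Hrho.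
have m0 : 0 <= m.
  by apply: le_trans (Hm 0 _); rewrite ?cmod_ge0 ?lexx ?ler01.
have near s r : cmod (s - z) < rho - r ->
    forall t, 0 <= t <= 1 -> r <= cmod (gamma t - s).
  move=> sz t /Hrho; have := cmodD (gamma t - s) (s - z).
  have -> : gamma t - s + (s - z) = gamma t - z by ring.
  lra.
have away s r : 0 < r -> (forall t, 0 <= t <= 1 -> r <= cmod (gamma t - s)) ->
    forall h t, cmod h < r / 2 -> 0 <= t <= 1 ->
    [/\ gamma t - s != 0, gamma t - (s + h) != 0,
        cmod (gamma t - s)^-1 <= r^-1 & cmod (gamma t - (s + h))^-1 <= (r / 2)^-1].
  move=> r0 Hr h t hr t01; have w := Hr t t01.
  have wh : r / 2 <= cmod (gamma t - (s + h)).
    have := cmodD (gamma t - (s + h)) h.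
    have -> : gamma t - (s + h) + h = gamma t - s by ring.
    lra.
  by split; rewrite -?cmod_gt0; try lra; apply: cmod_inv_le => //; lra.
have D1 s r : 0 < r -> (forall t, 0 <= t <= 1 -> r <= cmod (gamma t - s)) ->
  rdiff (fun s => unit_integral (fun t => phi t / (gamma t - s))) s
    (unit_integral (fun t => phi t / (gamma t - s) ^+ 2)) 0.
  move=> r0 Hr; have {Hr} A := away s r r0 Hr.
  apply: (@rdiff_unit_integral _ _ _ (m * (r^-1 * r^-1 * (r / 2)^-1)) (r / 2)).
  - by lra.
  - by rewrite !mulr_ge0 // invr_ge0; lra.
  - move=> h hr; exists (m * (r / 2)^-1) => t t01; have [_ _ _ ?] := A h t hr t01.
    by apply: cmodM_le => //; exact: Hm.
  - exists (m * (r^-1 * r^-1)) => t t01.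
    have [_ _ ? _] := A 0 t ltac:(rewrite cmod0; lra) t01.
    by rewrite expr2 invfM; apply: cmodM_le; [exact: Hm|exact: cmodM_le].
  - move=> h t hr t01; have [n1 n2 l1 l2] := A h t hr t01.
    have -> : phi t / (gamma t - (s + h)) - phi t / (gamma t - s)
        - h * (phi t / (gamma t - s) ^+ 2) =
      phi t * ((gamma t - s)^-1 * (gamma t - s)^-1 * (gamma t - (s + h))^-1) * (h * h).
      by field; rewrite n1 n2.
    rewrite [leLHS]cmodM (cmodM h) expr2 ler_wpM2r ?mulr_ge0 ?cmod_ge0 //.
    by do 3 (try apply: cmodM_le => //); exact: Hm.
have D2 s r : 0 < r -> (forall t, 0 <= t <= 1 -> r <= cmod (gamma t - s)) ->
  rdiff (fun s => unit_integral (fun t => phi t / (gamma t - s) ^+ 2)) s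
    (unit_integral (fun t => 2 * phi t / (gamma t - s) ^+ 3)) 0.
  move=> r0 Hr; have {Hr} A := away s r r0 Hr.
  pose k := r^-1 * r^-1 * (r / 2)^-1 * (2 * r^-1 + (r / 2)^-1).
  apply: (@rdiff_unit_integral _ _ _ (m * k) (r / 2)).
  - by lra.
  - have ri : 0 <= r^-1 by rewrite invr_ge0 ltW.
    have ri2 : 0 <= (r / 2)^-1 by rewrite invr_ge0; lra.
    by rewrite /k !mulr_ge0 // addr_ge0 // mulr_ge0.
  - move=> h hr; exists (m * ((r / 2)^-1 * (r / 2)^-1)) => t t01.
    have [_ _ _ ?] := A h t hr t01.
    by rewrite expr2 invfM; apply: cmodM_le; [exact: Hm|exact: cmodM_le].
  - exists (2 * m * (r^-1 * (r^-1 * r^-1))) => t t01.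
    have [_ _ ? _] := A 0 t ltac:(rewrite cmod0; lra) t01.
    rewrite exprS expr2 !invfM; apply: cmodM_le.
      by apply: cmodM_le; [rewrite cmod_nat|exact: Hm].
    by do 2 (apply: cmodM_le => //).
  - move=> h t hr t01; have [n1 n2 l1 l2] := A h t hr t01.
    have -> : phi t / (gamma t - (s + h)) ^+ 2 - phi t / (gamma t - s) ^+ 2
        - h * (2 * phi t / (gamma t - s) ^+ 3) =
      phi t * ((gamma t - s)^-1 * (gamma t - s)^-1 * (gamma t - (s + h))^-1
        * (2 * (gamma t - s)^-1 + (gamma t - (s + h))^-1)) * (h * h).
      by field; rewrite n1 n2.
    rewrite [leLHS]cmodM (cmodM h) expr2 ler_wpM2r ?mulr_ge0 ?cmod_ge0 //.
    apply: cmodM_le; first exact: Hm.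
    apply: cmodM_le; first by do 2 (apply: cmodM_le => //).
    apply: (le_trans (cmodD _ _)); apply: lerD => //.
    by apply: cmodM_le => //; rewrite cmod_nat.
exists (fun s => unit_integral (fun t => phi t / (gamma t - s) ^+ 2)).
  exists (rho / 2); first by lra.
  move=> h hd; apply: (D1 _ (rho / 2)); first by lra.
  by apply: near; rewrite addrC addKr; lra.
by exists (unit_integral (fun t => 2 * phi t / (gamma t - z) ^+ 3)); exact: D2 Hrho.
Qed.

Lemma twice_diff_near f u z (d : R) : 0 < d ->
  (forall h, cmod h < d -> f (z + h) = u (z + h)) -> twice_diff f z -> twice_diff u z.
Proof.
move=> d0 fu [f' [d' d'0 H] H2]; exists f' => //.
have e0 : 0 < Num.min d d' / 2 by rewrite divr_gt0 // lt_min d0.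
exists (Num.min d d' / 2) => // h hd.
have /andP[h1 h2] : (cmod h < d / 2) && (cmod h < d' / 2).
  by move: hd; rewrite !ltr_pdivlMr // lt_min.
apply: (@rdiff_near R f _ _ _ _ (d / 2)); first by lra.
  by move=> k kd; rewrite -!addrA fu //; apply: le_lt_trans (cmodD _ _) _; lra.
by apply: H; lra.
Qed.

Lemma twice_diff_lin f u z c : twice_diff f z -> twice_diff u z ->
  twice_diff (fun s => f s + c * u s) z.
Proof.
move=> [f' [d d0 H] [b Hb]] [u' [d' d'0 H'] [b' Hb']].
exists (fun s => f' s + c * u' s).
  exists (Num.min d d'); first by rewrite lt_min d0.
  move=> h; rewrite lt_min => /andP[/H fh /H' uh].
  by have := rdiffD fh (rdiffMl c uh); rewrite mulr0 addr0.
by exists (b + c * b'); have := rdiffD Hb (rdiffMl c Hb'); rewrite mulr0 addr0.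
Qed.

Lemma twice_diff_div f u z : u z != 0 -> twice_diff f z -> twice_diff u z ->
  twice_diff (fun s => f s / u s) z.
Proof.
move=> uz [f' [d d0 H] [b Hb]] [u' [d' d'0 H'] [b' Hb']].
have Hf : rdiff f z (f' z) 0 by have := H 0; rewrite addr0 cmod0; exact.
have Hu : rdiff u z (u' z) 0 by have := H' 0; rewrite addr0 cmod0; exact.
exists (fun s => (f' s * u s - f s * u' s) / u s ^+ 2).
  have uz0 : 0 < cmod (u z) by rewrite cmod_gt0.
  have [d'' d''0 H''] := rdiff_continuous Hu uz0.
  exists (Num.min (Num.min d d') d''); first by rewrite !lt_min d0 d'0.
  move=> h; rewrite !lt_min => /andP[/andP[/H fh /H' uh] /H'' nz].
  apply: rdiff_div => //; rewrite -cmod_gt0.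
  have := cmodB (u (z + h)) (u (z + h) - u z).
  have -> : u (z + h) - (u (z + h) - u z) = u z by ring.
  lra.
have D1 := rdiffB (rdiffM Hb Hu) (rdiffM Hf Hb').
have D2 := rdiffM Hu Hu.
rewrite !(mul0r, mulr0, addr0, subr0) in D1 D2.
eexists; apply: (rdiff_near ltr01 _ (rdiff_div _ D1 D2)).
  by move=> h _; rewrite expr2.
by rewrite mulf_neq0.
Qed.

End CauchyTransform.

(** * Derivatives of holomorphic functions are holomorphic *)
Section HolomorphicDerivative.
Variable R : realType.
Local Notation C := R[i].
Implicit Types (f F : C -> C) (z : C).

Let ctr : C := Complex 2^-1 2^-1.

Definition boundary_integral F : C :=
  unit_integral (fun t => F (Complex t 0))
  + (-1) * unit_integral (fun t => F (Complex t 1))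
  + 'i%C * unit_integral (fun t => F (Complex 1 t))
  + (- 'i%C) * unit_integral (fun t => F (Complex 0 t)).

Lemma boundary_integralE F : boundary_integral F = square_integral F 0 0 1.
Proof.
by rewrite /square_integral !add0r !prefix_integral0 !subr0 /boundary_integral
  /unit_integral; ring.
Qed.

Lemma boundary_far (h : C) t : cmod h < 4^-1 ->
  [/\ 4^-1 <= cmod (Complex t 0 - (ctr + h)),
      4^-1 <= cmod (Complex t 1 - (ctr + h)),
      4^-1 <= cmod (Complex 1 t - (ctr + h)) &
      4^-1 <= cmod (Complex 0 t - (ctr + h))].
Proof.
move=> h4.
have far (w : C) : 2^-1 <= cmod (w - ctr) -> 4^-1 <= cmod (w - (ctr + h)).
  have := cmodD (w - (ctr + h)) h.
  have -> : w - (ctr + h) + h = w - ctr by ring.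
  lra.
have im (w : C) : `|complex.Im w - 2^-1| = 2^-1 -> 2^-1 <= cmod (w - ctr).
  by case: w => a b /= e; rewrite -{1}e; exact: (ge_Im_cmod (Complex a b - ctr)).
have re (w : C) : `|complex.Re w - 2^-1| = 2^-1 -> 2^-1 <= cmod (w - ctr).
  by case: w => a b /= e; rewrite -{1}e; exact: (ge_Re_cmod (Complex a b - ctr)).
have e0 : `|0 - 2^-1| = 2^-1 :> R by rewrite sub0r normrN ger0_norm // invr_ge0.
have e1 : `|1 - 2^-1| = 2^-1 :> R by rewrite ger0_norm; lra.
by split; apply: far; [exact: im|exact: im|exact: re|exact: re].
Qed.

Definition sides_bounded F :=
  [/\ unit_bounded (fun t => F (Complex t 0)),
      unit_bounded (fun t => F (Complex t 1)),
      unit_bounded (fun t => F (Complex 1 t)) &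
      unit_bounded (fun t => F (Complex 0 t))].

Lemma boundary_unit_bounded F (m : R) : square_bounded F m -> sides_bounded F.
Proof.
by move=> Fm; split; exists m => t t01; apply: Fm => //; rewrite lexx ler01.
Qed.

Lemma boundary_integral_linear F (G : C -> C) c :
  sides_bounded F -> sides_bounded G ->
  boundary_integral (fun s => F s + c * G s) =
  boundary_integral F + c * boundary_integral G.
Proof.
move=> [F1 F2 F3 F4] [G1 G2 G3 G4].
by rewrite /boundary_integral !unit_integral_linear //; ring.
Qed.

Lemma kernel_bounded F (m : R) h : square_bounded F m -> cmod h < 4^-1 ->
  sides_bounded (fun s => F s / (s - (ctr + h))).
Proof.
move=> Fm h4; split; exists (m * 4^-1^-1) => t t01;
  have [b1 b2 b3 b4] := boundary_far t h4;
  by apply: cmodM_le; [apply: Fm => //; rewrite lexx ler01 | apply: cmod_inv_le].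
Qed.

Lemma twice_diff_boundary F (m : R) : square_bounded F m ->
  twice_diff (fun z => boundary_integral (fun s => F s / (s - z))) ctr.
Proof.
move=> Fm; have [b1 b2 b3 b4] := boundary_unit_bounded Fm.
have c0 : cmod (0 : C) < 4^-1 by rewrite cmod0 invr_gt0.
have q0 : 0 < 4^-1 :> R by rewrite invr_gt0.
have far t := boundary_far t c0.
rewrite /boundary_integral.
by refine (twice_diff_lin _ (twice_diff_lin _ (twice_diff_lin _ _ _) _) _);
  apply: (twice_diff_cauchy q0) => // t _; have [] := far t; rewrite addr0.
Qed.

(** In the sum of the integrands over the four sides the real parts cancel and the
imaginary parts agree: with [q = (t - 1/2) ^+ 2 + 1/4] the sum is [2 i / q],
between [4 i] and [8 i].  Its mean thus differs from [6 i] by at most [4]. *)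
Lemma winding_neq0 : boundary_integral (fun s => 1 / (s - ctr)) != 0.
Proof.
have one1 : square_bounded (fun=> 1 : C) 1.
  by move=> x y _ _; rewrite -[X in cmod X]/(Complex 1 0 : C) cmod_real normr1.
have c0 : cmod (0 : C) < 4^-1 by rewrite cmod0 invr_gt0.
have [] := kernel_bounded one1 c0; rewrite addr0 => b1 b2 b3 b4.
have -> : boundary_integral (fun s => 1 / (s - ctr)) = unit_integral (fun t =>
    1 / (Complex t 0 - ctr) + (-1) * (1 / (Complex t 1 - ctr))
    + 'i%C * (1 / (Complex 1 t - ctr)) + (- 'i%C) * (1 / (Complex 0 t - ctr))).
  rewrite !unit_integral_linear //; do 2 (try apply: unit_bounded_lin => //).
set S := fun t : R => _.
have SE t : S t = Complex 0 (2 / ((t - 2^-1) ^+ 2 + 4^-1)).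
  have n0 : (t - 2^-1) ^+ 2 + 4^-1 != 0 :> R.
    by rewrite gt_eqF //; have := sqr_ge0 (t - 2^-1); lra.
  rewrite /S !mul1r; apply/eqP; rewrite eq_complex /=.
  have -> : (0 - 2^-1) ^+ 2 = 4^-1 :> R by field.
  have -> : (1 - 2^-1) ^+ 2 = 4^-1 :> R by field.
  rewrite ![4^-1 + _]addrC; move: (_ + 4^-1) n0 => n n0.
  by apply/andP; split; apply/eqP; field.
have S6 t : 0 <= t <= 1 -> cmod (S t - Complex 0 6) <= 2.
  move=> t01; rewrite SE.
  have -> : Complex 0 (2 / ((t - 2^-1) ^+ 2 + 4^-1)) - Complex 0 6 =
    Complex 0 (2 / ((t - 2^-1) ^+ 2 + 4^-1) - 6).
    by apply/eqP; rewrite eq_complex /= subr0 !eqxx.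
  have q0 : 0 <= (t - 2^-1) ^+ 2 <= 4^-1.
    rewrite sqr_ge0 /=; have -> : (t - 2^-1) ^+ 2 = 4^-1 - t * (1 - t) by field.
    by rewrite gerBl; apply: mulr_ge0; lra.
  move: (_ ^+ 2) q0 => q q0; have q40 : 0 < q + 4^-1 by lra.
  rewrite cmod_imag ler_norml; apply/andP; split.
    have : 4 <= 2 / (q + 4^-1) by (rewrite ler_pdivlMr //; lra).
    lra.
  have : 2 / (q + 4^-1) <= 8 by (rewrite ler_pdivrMr //; lra).
  lra.
have Sb : unit_bounded S.
  by apply: unit_bounded_lin => //; apply: unit_bounded_lin => //; apply: unit_bounded_lin.
have := unit_integral_close Sb S6; apply: contraTneq => ->.
by rewrite sub0r cmodN cmod_imag ger0_norm // -ltNge; lra.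
Qed.

(** Cauchy's formula divided by the winding integral: near the center [f] is the
quotient of the Cauchy integrals of [f] and of [1]. *)
Lemma twice_diff_square f (m : R) : square_bounded f m ->
  (forall x y, 0 <= x <= 1 -> 0 <= y <= 1 -> exists a, rdiff f (Complex x y) a 0) ->
  twice_diff f ctr.
Proof.
move=> fm fd.
have b1 : square_bounded (fun=> 1 : C) 1.
  by move=> x y _ _; rewrite -[X in cmod X]/(Complex 1 0 : C) cmod_real normr1.
have U := twice_diff_boundary fm; have V := twice_diff_boundary b1.
have W := @twice_diff_div _ _ (fun z => boundary_integral (fun s => 1 / (s - z)))
  _ winding_neq0 U V.
have near_ctr h : cmod h < 4^-1 ->
    exists x y, [/\ 0 <= x <= 1, 0 <= y <= 1 & ctr + h = Complex x y].
  case: h => a b h4; exists (2^-1 + a), (2^-1 + b).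
  have := le_lt_trans (ge_Re_cmod _) h4; have := le_lt_trans (ge_Im_cmod _) h4.
  by rewrite /= !ltr_norml => ? ?; split=> //; lra.
have cauchy h : cmod h < 4^-1 ->
    boundary_integral (fun s => f s / (s - (ctr + h))) =
    f (ctr + h) * boundary_integral (fun s => 1 / (s - (ctr + h))).
  move=> h4; have [x0 [y0 [x01 y01 zE]]] := near_ctr h h4.
  pose G s := f s / (s - (ctr + h)) + (- f (ctr + h)) * (1 / (s - (ctr + h))).
  have GE s : G s = (f s - f (ctr + h)) / (s - (ctr + h)) by rewrite /G; ring.
  suff : boundary_integral G = 0.
    rewrite boundary_integral_linear;
      [|exact: kernel_bounded fm h4|exact: kernel_bounded b1 h4].
    by rewrite mulNr => /eqP; rewrite subr_eq0 => /eqP.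
  have [a fz] := fd _ _ x01 y01; rewrite -zE in fz.
  have [k k0 [d d0 K]] := rdiff_lipschitz fz.
  have m0 : 0 <= m.
    by apply: le_trans (fm 0 0 _ _); rewrite ?cmod_ge0 ?lexx ?ler01.
  (* Near the exceptional point the quotient is bounded by a Lipschitz constant
     of [f], elsewhere by the bound of [f] over the distance.  At the point itself
     the convention [0^-1 = 0] gives the harmless value 0. *)
  rewrite boundary_integralE; apply: (@goursat_punctured _ G (k + (m + m) * d^-1) (ctr + h)).
    move=> x y hx hy; rewrite GE.
    have dd : 0 <= d^-1 by rewrite invr_ge0 ltW.
    have [near|far] := ltP (cmod (Complex x y - (ctr + h))) d.
      have := K _ near; rewrite [ctr + h + _]addrC subrK => K1.
      have [->|nz] := eqVneq (Complex x y - (ctr + h)) 0.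
        by rewrite invr0 mulr0 cmod0; nra.
      rewrite cmodM cmodV; apply: (@le_trans _ _ k); last by nra.
      by rewrite ler_pdivrMr // cmod_gt0.
    apply: (@le_trans _ _ ((m + m) * d^-1)); last by lra.
    apply: cmodM_le; last exact: cmod_inv_le.
    by apply: (le_trans (cmodB _ _)); rewrite zE; apply: lerD; exact: fm.
  move=> x y hx hy nz; have [a' fxy] := fd x y hx hy.
  have D := rdiffB fxy (rdiff_cst (f (ctr + h)) (Complex x y)).
  have E := rdiffB (rdiff_id (Complex x y)) (rdiff_cst (ctr + h) (Complex x y)).
  rewrite -subr_eq0 in nz; rewrite !subr0 in D E.
  have Q := @rdiff_div R _ (fun s => s - (ctr + h)) _ _ _ nz D E.
  by eexists; apply: (rdiff_near ltr01 _ Q) => s _; rewrite GE.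
have [d d0 Hd] : exists2 d : R, 0 < d & forall h, cmod h < d ->
    boundary_integral (fun s => 1 / (s - (ctr + h))) != 0.
  have [v' [d d0 H] _] := V.
  have v0 : rdiff (fun z => boundary_integral (fun s => 1 / (s - z))) ctr (v' ctr) 0.
    by have := H 0; rewrite addr0 cmod0; exact.
  have w0 := winding_neq0; rewrite -cmod_gt0 in w0.
  have [d' d'0 H'] := rdiff_continuous v0 w0; exists d' => // h /H' hd.
  rewrite -cmod_gt0; set A := boundary_integral _; set B := boundary_integral _ in w0 hd.
  have := cmodB A (A - B); have -> : A - (A - B) = B by ring.
  by move: hd; rewrite -/A; lra.
have e0 : 0 < Num.min d 4^-1 by rewrite lt_min d0 /= invr_gt0 ltr0n.
apply: (twice_diff_near e0 _ W) => h; rewrite lt_min => /andP[/Hd nz h4].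
by rewrite cauchy // mulfK.
Qed.

(** A small square around [z] on which [f] is defined and bounded is rescaled to
the unit square. *)
Theorem holomorphic_deriv_differentiable (D : set C) f z :
  open (D : set C^o) -> holomorphic_on D f -> D z -> exists b, rdiff (cderiv f) z b 0.
Proof.
move=> oD fD Dz.
have fr s : D s -> rdiff f s (cderiv f s) 0 by move=> /fD; exact: derivable_rdiff.
have [d1 d10 H1] := open_cmod oD Dz.
have [d2 d20 H2] := rdiff_continuous (fr z Dz) ltr01.
have dm : 0 < Num.min d1 d2 by rewrite lt_min d10.
pose r := Num.min d1 d2 / 2; have r0 : 0 < r by rewrite /r; lra.
have [rd1 rd2] : r < d1 /\ r < d2.
  have : Num.min d1 d2 <= d1 by rewrite ge_min lexx.
  have : Num.min d1 d2 <= d2 by rewrite ge_min lexx orbT.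
  rewrite /r; lra.
pose rc : C := Complex r 0.
have rc0 : rc != 0 by rewrite -cmod_gt0 cmod_real normr_gt0 gt_eqF.
pose F (s : C) := f (z + rc * (s - ctr)).
have inD x y : 0 <= x <= 1 -> 0 <= y <= 1 -> cmod (rc * (Complex x y - ctr)) <= r.
  move=> hx hy; rewrite cmodM cmod_real gtr0_norm //; apply: ler_piMr; first exact: ltW.
  apply: (le_trans (cmod_le_ReIm _)) => /=.
  have : `|x - 2^-1| <= 2^-1 by rewrite ler_norml; lra.
  have : `|y - 2^-1| <= 2^-1 by rewrite ler_norml; lra.
  lra.
have Fm : square_bounded F (1 + cmod (f z)).
  move=> x y hx hy; have := H2 _ (le_lt_trans (inD x y hx hy) rd2).
  have := cmodD (F (Complex x y) - f z) (f z); rewrite subrK /F; lra.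
have Fd x y : 0 <= x <= 1 -> 0 <= y <= 1 -> exists a, rdiff F (Complex x y) a 0.
  move=> hx hy; have Dxy := H1 _ (le_lt_trans (inD x y hx hy) rd1).
  have aff : rdiff (fun s => z + rc * (s - ctr)) (Complex x y)
      (0 + rc * (1 - 0)) (0 + rc * (0 - 0)).
    exact: rdiffD (rdiff_cst _ _) (rdiffMl rc (rdiffB (rdiff_id _) (rdiff_cst _ _))).
  have := @rdiff_comp R f (fun s => z + rc * (s - ctr)) _ _ _ _ (fr _ Dxy) aff.
  by rewrite !subr0 !mulr0 addr0 mulr0 => FF; eexists; exact: FF.
have [F' [d d0 HF] [b Hb]] := twice_diff_square Fm Fd.
pose back (s : C) := ctr + rc^-1 * (s - z).
have backz s : rdiff back s rc^-1 0.
  have := rdiffD (rdiff_cst ctr s) (rdiffMl rc^-1 (rdiffB (rdiff_id s) (rdiff_cst z s))).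
  by rewrite !subr0 !mulr0 !add0r mulr1.
have fE s : f s = F (back s) by rewrite /F /back; congr f; field.
have derivE h : cmod h < Num.min d1 (r * d) ->
    cderiv f (z + h) = F' (back (z + h)) * rc^-1.
  rewrite lt_min => /andP[/H1 Dh hd].
  apply: rdiff_unique (fr _ Dh) _.
  have bE : back (z + h) = ctr + rc^-1 * h by rewrite /back; ring.
  have : rdiff F (back (z + h)) (F' (back (z + h))) 0.
    rewrite bE; apply: HF; rewrite cmodM cmodV cmod_real gtr0_norm //.
    by rewrite mulrC ltr_pdivrMr // mulrC.
  move=> /(rdiff_comp (f := back)) /(_ (backz _)).
  by rewrite mulr0; apply: (rdiff_near ltr01) => k _; rewrite /= -fE.
have backc : back z = ctr by rewrite /back subrr mulr0 addr0.
rewrite -backc in Hb.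
have := rdiffMl rc^-1 (rdiff_comp (f := back) Hb (backz z)).
rewrite !mulr0 => D2; eexists.
apply: (rdiff_near (d := Num.min d1 (r * d))) D2; first by rewrite lt_min d10 mulr_gt0.
by move=> h /derivE ->; rewrite mulrC.
Qed.

End HolomorphicDerivative.

(** * Derivatives of the network along a curve of weights *)
Section NetworkDerivatives.
Variables (R : realType) (L : nat) (K : nat -> nat) (N : nat).
Local Notation C := R[i].
Variables (g : nat -> C -> C) (Omega : nat -> set C).
Variables (z : 'I_N -> 'cV[C]_(K 0%N)) (d : 'I_N -> 'cV[C]_(K L)).
Local Notation weights := (weights R K).
Implicit Types (w E : weights) (t : 'I_N) (p q : nat).

(** The derivative of the activations when the weights [w] move in the direction
[E]: forward differentiation of the recursion [act]. *)
Fixpoint dact w E t p : 'cV[C]_(K p) :=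
  match p with
  | 0 => 0
  | q.+1 => \col_j (cderiv (g q.+1) (net g z w t q j 0)
                    * (E q *m act g z w t q + w q *m dact w E t q) j 0)
  end.

Definition dnet w E t p : 'cV[C]_(K p.+1) :=
  E p *m act g z w t p + w p *m dact w E t p.

Lemma actS w t p i : act g z w t p.+1 i 0 = g p.+1 (net g z w t p i 0).
Proof. by rewrite /= mxE. Qed.

Lemma dactS w E t p i : dact w E t p.+1 i 0 =
  cderiv (g p.+1) (net g z w t p i 0) * dnet w E t p i 0.
Proof. by rewrite /= mxE. Qed.

Hypothesis Omega_open : forall p, (p < L)%N -> open (Omega p.+1 : set C^o).
Hypothesis g_holo : forall p, (p < L)%N -> holomorphic_on (Omega p.+1) (g p.+1).

Lemma g_rdiff p s : (p < L)%N -> Omega p.+1 s ->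
  rdiff (g p.+1) s (cderiv (g p.+1) s) 0.
Proof. by move=> pL Os; apply: derivable_rdiff; exact: g_holo. Qed.

Lemma g_deriv_rdiff p s : (p < L)%N -> Omega p.+1 s ->
  exists b, rdiff (cderiv (g p.+1)) s b 0.
Proof.
move=> pL; exact: holomorphic_deriv_differentiable (Omega_open pL) (g_holo pL).
Qed.

Lemma rdiff_mulmx m n (A : C -> 'M[C]_(m, n)) (x : C -> 'cV[C]_n)
  (A' : 'M[C]_(m, n)) (x' : 'cV[C]_n) s :
  (forall i j, rdiff (fun u => A u i j) s (A' i j) 0) ->
  (forall j, rdiff (fun u => x u j 0) s (x' j 0) 0) ->
  forall i, rdiff (fun u => (A u *m x u) i 0) s ((A' *m x s + A s *m x') i 0) 0.
Proof.
move=> HA Hx i.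
have := rdiff_sum (fun j => rdiffM (HA i j) (Hx j)).
have -> : \sum_j (A' i j * x s j 0 + A s i j * x' j 0) =
  (A' *m x s + A s *m x') i 0 by rewrite !mxE big_split.
have -> : \sum_j (0 * x s j 0 + A s i j * 0) = 0.
  by rewrite big1 // => j _; rewrite mul0r mulr0 addr0.
by apply: (rdiff_near ltr01) => h _; rewrite mxE.
Qed.

Section Curve.
Variables (W : C -> weights) (E : weights) (s : C).
Hypothesis W_rdiff : forall p i j, rdiff (fun u => W u p i j) s (E p i j) 0.
Hypothesis W_adm : admissible L g z Omega (W s).

Lemma act_rdiff t p : (p <= L)%N -> forall i,
  rdiff (fun u => act g z (W u) t p i 0) s (dact (W s) E t p i 0) 0.
Proof.
elim: p => [|p IH] pL i.
  by rewrite mxE; exact: (rdiff_cst (z t i 0) s).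
have Hn := rdiff_mulmx (@W_rdiff p) (IH (ltnW pL)) i.
have := cdiff_comp (f := fun u => net g z (W u) t p i 0) (g_rdiff pL (W_adm t i pL)) Hn.
rewrite -dactS.
by apply: (rdiff_near ltr01) => h _; rewrite actS.
Qed.

Lemma net_rdiff t p : (p < L)%N -> forall i,
  rdiff (fun u => net g z (W u) t p i 0) s (dnet (W s) E t p i 0) 0.
Proof. by move=> pL; apply: rdiff_mulmx => // j; exact: act_rdiff (ltnW pL) j. Qed.

(** Here the differentiability of [g'] enters.  The value of the second derivative
stays existential: in the Hessian it occurs under a conjugation and therefore
contributes to the derivative in [conj w], not to the one in [w]. *)
Lemma dact_rdiff E' t p : (p <= L)%N -> forall i,
  exists b, rdiff (fun u => dact (W u) E' t p i 0) s b 0.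
Proof.
elim: p => [|p IH] pL i.
  by exists 0; apply: (rdiff_near ltr01) (rdiff_cst 0 s) => h _; rewrite mxE.
have [x' Hx] : exists x' : 'cV[C]_(K p), forall j,
    rdiff (fun u => dact (W u) E' t p j 0) s (x' j 0) 0.
  have /choice[x' Hx] := IH (ltnW pL).
  by exists (\col_j x' j) => j; rewrite mxE.
have E'c j k : rdiff (fun=> E' p j k) s ((0 : 'M[C]_(_, _)) j k) 0.
  by rewrite mxE; exact: rdiff_cst.
have Hn := cdiffD (rdiff_mulmx E'c (act_rdiff t (ltnW pL)) i)
  (rdiff_mulmx (@W_rdiff p) Hx i).
have [b Hb] := g_deriv_rdiff pL (W_adm t i pL).
have Hc := cdiff_comp (f := fun u => net g z (W u) t p i 0) Hb (net_rdiff t pL i).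
have H := cdiffM Hc Hn; eexists.
by apply: (rdiff_near ltr01) H => h _; rewrite dactS; congr (_ * _); rewrite [RHS]mxE.
Qed.

End Curve.

End NetworkDerivatives.

(** * The gradient and the Hessian of the error *)
Section ErrorDerivatives.
Variables (R : realType) (L : nat) (K : nat -> nat) (N : nat).
Local Notation C := R[i].
Variables (g : nat -> C -> C) (Omega : nat -> set C).
Variables (z : 'I_N -> 'cV[C]_(K 0%N)) (d : 'I_N -> 'cV[C]_(K L)).
Local Notation weights := (weights R K).
Implicit Types (w E : weights) (t : 'I_N) (p q : nat).

Hypothesis Omega_open : forall p, (p < L)%N -> open (Omega p.+1 : set C^o).
Hypothesis g_holo : forall p, (p < L)%N -> holomorphic_on (Omega p.+1) (g p.+1).
Hypothesis Omega_conj : forall p s, (p < L)%N -> Omega p.+1 s -> Omega p.+1 s^*.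
Hypothesis g_conj : forall p s, (p < L)%N -> Omega p.+1 s ->
  (g p.+1 s)^* = g p.+1 s^*.

(** Conjugating before and after turns the derivative into its conjugate, and by
the symmetry of [g] this operation does not change [g] near the point. *)
Lemma cderiv_conj p s : (p < L)%N -> Omega p.+1 s ->
  cderiv (g p.+1) s^* = (cderiv (g p.+1) s)^*.
Proof.
move=> pL Os; have Oc := Omega_conj pL Os.
have D := g_rdiff g_holo pL Os.
apply: rdiff_unique (g_rdiff g_holo pL Oc) _.
have [e e0 H] := open_cmod (Omega_open pL) Os.
have := rdiff_conj_conj D; rewrite conjC0.
apply: (rdiff_near e0) => h he; rewrite g_conj //.
  by rewrite conjCK.
by rewrite rmorphD /= conjCK; apply: H; rewrite cmodJ.
Qed.

Lemma near_finite (I : finType) (P : I -> C -> Prop) :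
  (forall i, exists2 e : R, 0 < e & forall h, cmod h < e -> P i h) ->
  exists2 e : R, 0 < e & forall h, cmod h < e -> forall i, P i h.
Proof.
move=> H; suff [e e0 He] : exists2 e : R, 0 < e &
    forall h, cmod h < e -> forall i, i \in enum I -> P i h.
  by exists e => // h he i; apply: He; rewrite ?mem_enum.
elim: (enum I) => [|i r [e e0 He]]; first by exists 1.
have [e' e'0 He'] := H i; exists (Num.min e e'); first by rewrite lt_min e0.
move=> h; rewrite lt_min => /andP[h1 h2] j; rewrite inE => /orP[/eqP ->|jr].
  exact: He'.
exact: He.
Qed.

(** There are finitely many net inputs, each in an open set. *)
Lemma admissible_near (W : C -> weights) E s :
  (forall p i j, rdiff (fun u => W u p i j) s (E p i j) 0) ->
  admissible L g z Omega (W s) ->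
  exists2 e : R, 0 < e & forall h, cmod h < e -> admissible L g z Omega (W (s + h)).
Proof.
move=> HW adm.
have [t|e e0 He] := @near_finite 'I_N (fun t h => forall (p : 'I_L) (j : 'I_(K p.+1)),
    Omega p.+1 (net g z (W (s + h)) t p j 0)).
  apply: near_finite => p; apply: near_finite => j.
  have [e e0 He] := open_cmod (Omega_open (ltn_ord p)) (adm t p j (ltn_ord p)).
  have [e' e'0 He'] := rdiff_continuous (net_rdiff g_holo HW adm t (ltn_ord p) j) e0.
  by exists e' => // h /He'/He; rewrite addrC subrK.
by exists e => // h he t p j pL; exact: He h he t (Ordinal pL) j.
Qed.

Definition layer_weights w p (u : 'cV[C]_(K p.+1 * K p)) : weights :=
  dfwith w p (of_vec u).

Definition layer_dir p (c : 'I_(K p.+1 * K p)) : weights :=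
  dfwith (fun q => 0) p (of_vec (delta_mx c 0)).

Lemma layer_weights_in w p (u : 'cV[C]_(K p.+1 * K p)) :
  layer_weights w u p = of_vec u.
Proof. exact: dfwith_in. Qed.

Lemma layer_weights_out w p q (u : 'cV[C]_(K p.+1 * K p)) : p != q ->
  layer_weights w u q = w q.
Proof. exact: dfwith_out. Qed.

Lemma layer_dir_in p (c : 'I_(K p.+1 * K p)) : layer_dir c p = of_vec (delta_mx c 0).
Proof. exact: dfwith_in. Qed.

Lemma layer_dir_out p q (c : 'I_(K p.+1 * K p)) : p != q -> layer_dir c q = 0.
Proof. exact: dfwith_out. Qed.

Lemma layer_weights_rdiff w p (u : 'cV[C]_(K p.+1 * K p)) c q i j s :
  rdiff (fun s => layer_weights w (u + s *: delta_mx c 0) q i j) s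
    (layer_dir c q i j) 0.
Proof.
have [e|ne] := eqVneq p q.
  subst q; have := rdiffD (rdiff_cst (of_vec u i j) s)
    (rdiffMl (of_vec (delta_mx c 0) i j : C) (rdiff_id s)).
  rewrite layer_dir_in mulr1 mulr0 !add0r; apply: (rdiff_near ltr01) => h _.
  by rewrite layer_weights_in /of_vec !mxE mulrC.
rewrite layer_dir_out // mxE.
apply: (rdiff_near ltr01) (rdiff_cst (w q i j) s) => h _.
by rewrite layer_weights_out.
Qed.

Local Notation output w t l := (act g z w t L l 0).
Local Notation doutput w c t l := (dact g z w (layer_dir c) t L l 0).

(** The derivative of the error with respect to one weight: the factor
[conj (y - d)] is constant for it. *)
Definition error_dw w p (c : 'I_(K p.+1 * K p)) : C :=
  N%:R^-1 * \sum_t \sum_l doutput w c t l * (output w t l - d t l 0)^*.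

Lemma error_rdiff w p (u : 'cV[C]_(K p.+1 * K p)) c :
  admissible L g z Omega (layer_weights w u) ->
  rdiff (along (layer_error g z d w (p := p)) u c) 0
    (error_dw (layer_weights w u) c)
    (error_dw (layer_weights w u) c)^*.
Proof.
move=> adm; have u0 : u + 0 *: delta_mx c 0 = u by rewrite scale0r addr0.
pose W s := layer_weights w (u + s *: delta_mx c 0).
have W0 : W 0 = layer_weights w u by rewrite /W u0.
have W_adm : admissible L g z Omega (W 0) by rewrite W0.
have Hout t l : rdiff (fun s => output (W s) t l - d t l 0) 0
    (doutput (layer_weights w u) c t l) 0.
  have := rdiffB (act_rdiff (W := W) g_holo
    (fun q i j => @layer_weights_rdiff w p u c q i j 0) W_adm t (leqnn L) l)
    (rdiff_cst (d t l 0) 0).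
  by rewrite !subr0 W0.
have := rdiffMl N%:R^-1 (rdiff_sum (fun t => rdiff_sum (fun l =>
  rdiffM (Hout t l) (rdiff_conj (Hout t l))))).
have -> : N%:R^-1 * \sum_t \sum_l (doutput (layer_weights w u) c t l
    * (output (W 0) t l - d t l 0)^* + (output (W 0) t l - d t l 0) * 0^*) =
    error_dw (layer_weights w u) c.
  rewrite W0 /error_dw; congr (_ * _); apply: eq_bigr => t _; apply: eq_bigr => l _.
  by rewrite conjC0 mulr0 addr0.
have -> : N%:R^-1 * \sum_t \sum_l (0 * (output (W 0) t l - d t l 0)^* +
    (output (W 0) t l - d t l 0) * (doutput (layer_weights w u) c t l)^*) =
    (error_dw (layer_weights w u) c)^*.
  rewrite W0 /error_dw rmorphM fmorphV rmorph_nat rmorph_sum; congr (_ * _).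
  apply: eq_bigr => t _; rewrite rmorph_sum; apply: eq_bigr => l _.
  by rewrite rmorphM /= mul0r add0r mulrC conjCK.
apply: (rdiff_near ltr01) => h _; rewrite /along /layer_error /error.
by congr (_ * _); apply: eq_bigr => t _; apply: eq_bigr => l _; rewrite normCK.
Qed.

(** In the conjugated gradient the residual [y - d] is the only holomorphic factor,
so just its derivative appears. *)
Lemma error_dw_rdiff w p (u : 'cV[C]_(K p.+1 * K p)) (r c : 'I_(K p.+1 * K p)) :
  admissible L g z Omega (layer_weights w u) ->
  exists b, rdiff (fun s => (error_dw (layer_weights w (u + s *: delta_mx c 0)) r)^*) 0
    (N%:R^-1 * \sum_t \sum_l doutput (layer_weights w u) c t l
                             * (doutput (layer_weights w u) r t l)^*) b.
Proof.
move=> adm; have u0 : u + 0 *: delta_mx c 0 = u by rewrite scale0r addr0.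
pose W s := layer_weights w (u + s *: delta_mx c 0).
have W0 : W 0 = layer_weights w u by rewrite /W u0.
have W_adm : admissible L g z Omega (W 0) by rewrite W0.
have W_rdiff q i j : rdiff (fun s => W s q i j) 0 (layer_dir c q i j) 0.
  exact: layer_weights_rdiff.
have Hout t l : rdiff (fun s => output (W s) t l - d t l 0) 0
    (doutput (layer_weights w u) c t l) 0.
  have := rdiffB (act_rdiff g_holo W_rdiff W_adm t (leqnn L) l) (rdiff_cst (d t l 0) 0).
  by rewrite !subr0 W0.
have Hdout t l := dact_rdiff Omega_open g_holo W_rdiff W_adm (layer_dir r) t (leqnn L) l.
have [b Hb] : exists b : 'I_N -> 'I_(K L) -> C, forall t l,
    rdiff (fun s => doutput (W s) r t l) 0 (b t l) 0.
  have /choice[b Hb] : forall tl : 'I_N * 'I_(K L), exists b,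
    rdiff (fun s => doutput (W s) r tl.1 tl.2) 0 b 0 by case=> t l; exact: Hdout.
  by exists (fun t l => b (t, l)) => t l; exact: (Hb (t, l)).
have := rdiff_conj (rdiffMl N%:R^-1 (rdiff_sum (fun t => rdiff_sum (fun l =>
  rdiffM (Hb t l) (rdiff_conj (Hout t l)))))).
set A := (_ * _)^*; set B := (_ * _)^* => H; eexists; move: H.
have -> : A = N%:R^-1 * \sum_t \sum_l doutput (layer_weights w u) c t l
                             * (doutput (layer_weights w u) r t l)^*.
  rewrite /A rmorphM fmorphV rmorph_nat rmorph_sum; congr (_ * _).
  apply: eq_bigr => t _; rewrite rmorph_sum; apply: eq_bigr => l _.
  by rewrite /= mul0r add0r W0 rmorphM /= conjCK mulrC.
by apply: (rdiff_near ltr01).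
Qed.

Lemma row_conjE n (v : 'rV[C]_n) i : (v ^t*) i 0 = (v 0 i)^*.
Proof. by rewrite !mxE. Qed.

(** The formula for the gradient holds at all admissible weights, hence on a
neighborhood along each coordinate line, and may be differentiated again. *)
Lemma layer_error_derivatives w p : admissible L g z Omega w ->
  let f := layer_error g z d w (p := p) in
  [/\ forall c, partial_derivable f (to_vec (w p)) c,
      forall r c, partial_derivable (fun u => ((grad (@dw R) f u) ^t*) r 0)
        (to_vec (w p)) c &
      forall r c, error_hess g z d w p r c =
        N%:R^-1 * \sum_t \sum_l doutput w c t l * (doutput w r t l)^*].
Proof.
move=> adm f.
have of_to : of_vec (to_vec (w p)) = w p by rewrite /of_vec /to_vec trmxK mxvecK.
have W0 : layer_weights w (to_vec (w p)) = w.
  apply: functional_extensionality_dep => q; have [e|ne] := eqVneq p q.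
    by subst q; rewrite layer_weights_in.
  by rewrite layer_weights_out.
have adm0 : admissible L g z Omega (layer_weights w (to_vec (w p))) by rewrite W0.
have gradE u c : admissible L g z Omega (layer_weights w u) ->
    grad (@dw R) f u 0 c = error_dw (layer_weights w u) c.
  by move=> /error_rdiff-/(_ c)/rdiff_wirtinger[_ <- _]; rewrite mxE.
have hess_rdiff r c : exists b,
    rdiff (along (fun u => ((grad (@dw R) f u) ^t*) r 0) (to_vec (w p)) c) 0
    (N%:R^-1 * \sum_t \sum_l doutput w c t l * (doutput w r t l)^*) b.
  have [b] := error_dw_rdiff r c adm0; rewrite W0 => Hb; exists b.
  have adm00 : admissible L g z Omega
      (layer_weights w (to_vec (w p) + 0 *: delta_mx c 0)).
    by rewrite scale0r addr0.
  have [e e0 He] := admissible_near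
    (fun q i j => @layer_weights_rdiff w p (to_vec (w p)) c q i j 0) adm00.
  apply: (rdiff_near e0 _ Hb) => h /He; rewrite add0r => hadm.
  by rewrite /along row_conjE gradE.
split.
- by move=> c; have /rdiff_wirtinger[] := error_rdiff c adm0.
- by move=> r c; have [b /rdiff_wirtinger[]] := hess_rdiff r c.
- move=> r c; have [b /rdiff_wirtinger[_ <- _]] := hess_rdiff r c.
  by rewrite /error_hess /hess mxE.
Qed.

Lemma dact_below w E t p : (forall q, (q < p)%N -> E q = 0) -> dact g z w E t p = 0.
Proof.
elim: p => [|p IH] // Ep; apply/matrixP => i j; rewrite (ord1 j) dactS [RHS]mxE.
have -> : dnet g z w E t p = 0.
  rewrite /dnet Ep // IH; last by move=> q qp; apply: Ep; exact: ltnW.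
  by rewrite mul0mx mulmx0 addr0.
by rewrite [X in _ * X]mxE mulr0.
Qed.

Lemma sesquilinear_sum (I J : finType) (A : I -> I -> C) (u v : I -> J -> C)
    (a b : J -> C) :
  \sum_eta \sum_beta A eta beta * (\sum_j u eta j * a j) * (\sum_k v beta k * b k) =
  \sum_j \sum_k (\sum_eta \sum_beta A eta beta * u eta j * v beta k) * a j * b k.
Proof.
transitivity (\sum_eta \sum_beta \sum_j \sum_k
    A eta beta * (u eta j * a j) * (v beta k * b k)).
  apply: eq_bigr => eta _; apply: eq_bigr => beta _.
  rewrite [A eta beta * _]mulr_sumr mulr_suml; apply: eq_bigr => j _.
  by rewrite mulr_sumr.
under eq_bigr do rewrite exchange_big.
rewrite exchange_big; apply: eq_bigr => j _ /=.
under eq_bigr do rewrite exchange_big.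
rewrite exchange_big; apply: eq_bigr => k _ /=.
rewrite !mulr_suml; apply: eq_bigr => eta _.
rewrite !mulr_suml; apply: eq_bigr => beta _; ring.
Qed.

(** Backward induction from the output layer.  The form in the derivatives of the
outputs is rewritten as a form in the derivatives of the net inputs of any layer
not below the one in which the weights move; its matrix is [gamma]. *)
Lemma gamma_pairing w (E1 E2 : weights) t p k q : admissible L g z Omega w ->
  (forall q, (p < q)%N -> E1 q = 0 /\ E2 q = 0) ->
  (p <= q)%N -> (q.+1 + k)%N = L ->
  \sum_l dact g z w E1 t L l 0 * (dact g z w E2 t L l 0)^* =
  \sum_eta \sum_beta gamma_rec g z w t k q eta beta
     * (dnet g z w E2 t q eta 0)^* * dnet g z w E1 t q beta 0.
Proof.
move=> adm Ep; elim: k q => [|k IH] q pq qk.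
  move: qk; rewrite addn0 => qL; have lqL : (q < L)%N by rewrite -qL.
  rewrite -[in LHS]qL; apply: eq_bigr => l _.
  rewrite (bigD1 l) //= big1 => [|b bl]; last first.
    by rewrite [X in X * _ * _]mxE eq_sym (negbTE bl) !mul0r.
  rewrite addr0 [X in _ = X * _ * _]mxE eqxx (cderiv_conj lqL (adm t q l lqL)).
  rewrite !dactS; move: (cderiv _ _) (dnet _ _ _ _ _ _ _ _)
    (dnet _ _ _ _ _ _ _ _) => G e1 e2.
  by rewrite rmorphM /=; ring.
rewrite (IH q.+1) ?addSnnS ?(leq_trans pq) //; last by rewrite -qk addSnnS.
have lqL : (q < L)%N by rewrite -qk leq_addr.
have [E1q E2q] := Ep q.+1 pq.
have dE E : E q.+1 = 0 -> forall i, dnet g z w E t q.+1 i 0 =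
    \sum_j w q.+1 i j * (cderiv (g q.+1) (net g z w t q j 0) * dnet g z w E t q j 0).
  move=> E0 i; rewrite /dnet E0 mul0mx add0r mxE; apply: eq_bigr => j _.
  by rewrite dactS.
have dE2 i : (dnet g z w E2 t q.+1 i 0)^* = \sum_j (w q.+1 i j)^*
    * (cderiv (g q.+1) (net g z w t q j 0) * dnet g z w E2 t q j 0)^*.
  by rewrite dE // rmorph_sum; apply: eq_bigr => j _; rewrite rmorphM.
transitivity (\sum_eta \sum_beta gamma_rec g z w t k q.+1 eta beta
    * (\sum_j (w q.+1 eta j)^*
         * (cderiv (g q.+1) (net g z w t q j 0) * dnet g z w E2 t q j 0)^*)
    * (\sum_j w q.+1 beta j
         * (cderiv (g q.+1) (net g z w t q j 0) * dnet g z w E1 t q j 0))).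
  apply: eq_bigr => eta _; apply: eq_bigr => beta _.
  by congr (_ * _ * _); [exact: dE2 | exact: dE].
rewrite sesquilinear_sum; apply: eq_bigr => j _; apply: eq_bigr => b _.
rewrite [in RHS]mxE (cderiv_conj lqL (adm t q j lqL)) rmorphM /=.
ring.
Qed.

Lemma dnet_layer_dir w p (j : 'I_(K p.+1)) (i : 'I_(K p)) t eta :
  dnet g z w (layer_dir (mxvec_index j i)) t p eta 0 =
  (eta == j)%:R * act g z w t p i 0.
Proof.
rewrite /dnet dact_below => [|q qp]; last by rewrite layer_dir_out // gtn_eqF.
rewrite mulmx0 addr0 layer_dir_in.
have -> : of_vec (delta_mx (mxvec_index j i) 0) = delta_mx j i :> 'M[C]_(_, _).
  by rewrite /of_vec trmx_delta vec_mx_delta.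
rewrite mxE (bigD1 i) //= big1 => [|k ki]; last by rewrite mxE (negbTE ki) andbF mul0r.
by rewrite addr0 mxE eqxx andbT.
Qed.

(** In its own layer a weight from node [i] into node [j] changes only the net input
of node [j], at the rate given by the activation of [i]; so one term of the form
survives. *)
Lemma error_hessE w p (j b : 'I_(K p.+1)) (i a : 'I_(K p)) :
  admissible L g z Omega w -> (p < L)%N ->
  error_hess g z d w p (mxvec_index j i) (mxvec_index b a) =
  N%:R^-1 * \sum_(t < N) gamma L g z w t p j b
              * (act g z w t p i 0)^* * act g z w t p a 0.
Proof.
move=> adm pL; have [_ _ ->] := @layer_error_derivatives w p adm.
congr (_ * _); apply: eq_bigr => t _.
have out q : (p < q)%N ->
    layer_dir (mxvec_index b a) q = 0 /\ layer_dir (mxvec_index j i) q = 0.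
  by move=> pq; rewrite !layer_dir_out // ltn_eqF.
rewrite (gamma_pairing (k := L - p.+1) t adm out (leqnn p)) ?subnKC // /gamma.
rewrite (bigD1 j) //= [X in _ + X]big1 => [|eta ne]; last first.
  rewrite big1 // => beta _; rewrite dnet_layer_dir (negbTE ne) mul0r conjC0.
  by rewrite mulr0 mul0r.
rewrite addr0 (bigD1 b) //= [X in _ + X]big1 => [|beta ne]; last first.
  by rewrite [X in _ * X]dnet_layer_dir (negbTE ne) mul0r mulr0.
by rewrite addr0 !dnet_layer_dir !eqxx !mul1r.
Qed.

End ErrorDerivatives.

(** * One sweep of backpropagation *)
Section Sweep.
Variables (R : realType) (L : nat) (K : nat -> nat).
Local Notation C := R[i].
Variable update : weights R K -> forall p, 'cV[C]_(K p.+1 * K p).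
Arguments update : clear implicits.
Implicit Types (w : weights R K) (p k n : nat).

Lemma of_vecK m n : cancel (@of_vec R m n) (@to_vec R m n).
Proof. by move=> v; rewrite /of_vec /to_vec vec_mxK trmxK. Qed.

Lemma update_layer_in mu w p : update_layer update mu w p p =
  of_vec (to_vec (w p) + Complex mu 0 *: update w p).
Proof. exact: dfwith_in. Qed.

Lemma update_layer_out mu w p q : p != q -> update_layer update mu w p q = w q.
Proof. exact: dfwith_out. Qed.

Lemma sweep_before mu w k p : (p < L - k)%N -> sweep L update mu k w p = w p.
Proof.
elim: k => [|k IH] //= pk; rewrite update_layer_out ?gtn_eqF //.
by apply: IH; apply: leq_trans pk _; rewrite leq_sub2l.
Qed.

Lemma sweep_after mu w p k : (p < L)%N -> (L - p + k <= L)%N ->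
  sweep L update mu (L - p + k) w p = sweep L update mu (L - p) w p.
Proof.
move=> pL; elim: k => [|k IH] kL; first by rewrite addn0.
rewrite addnS /= update_layer_out ?IH //; lia.
Qed.

(** Within one sweep a layer keeps its weights until its turn, because only higher
layers have been updated, and keeps the updated ones afterwards. *)
Lemma backprop_layer (mu : nat -> R) w0 n p : (p < L)%N ->
  to_vec (backprop L update mu w0 n.+1 p) =
  to_vec (backprop L update mu w0 n p)
  + Complex (mu n) 0 *: update (current L update mu w0 n p) p.
Proof.
move=> pL; rewrite /current /=; set w := backprop L update mu w0 n.
have -> : sweep L update (mu n) L w p = sweep L update (mu n) (L - p) w p.
  by have := @sweep_after (mu n) w p p pL; rewrite subnK ?(ltnW pL) //; apply.
rewrite -(subnSK pL) /=; have -> : (L - (L - p.+1).+1 = p)%N by lia.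
rewrite update_layer_in of_vecK sweep_before //; lia.
Qed.

End Sweep.

Theorem corollary5p1 (R : realType) (L : nat) (K : nat -> nat) (N : nat)
  (g : nat -> R[i] -> R[i]) (Omega : nat -> set R[i])
  (z : 'I_N -> 'cV[R[i]]_(K 0%N)) (d : 'I_N -> 'cV[R[i]]_(K L))
  (L_ge1 : (1 <= L)%N) (N_ge1 : (1 <= N)%N)
  (Omega_domain : forall p, (1 <= p <= L)%N -> complex_domain (Omega p))
  (Omega_conj : forall p, (1 <= p <= L)%N ->
     forall s, Omega p s -> Omega p (s^*))
  (g_holomorphic : forall p, (1 <= p <= L)%N -> holomorphic_on (Omega p) (g p))
  (g_conj : forall p, (1 <= p <= L)%N ->
     forall s, Omega p s -> (g p s)^* = g p (s^*)) :
  (forall (w : weights R K) (p : nat), admissible L g z Omega w -> (p < L)%N ->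
     [/\ forall c,
           partial_derivable (layer_error g z d w (p := p)) (to_vec (w p)) c,
         forall r c,
           partial_derivable
             (fun u => ((grad (@dw R) (layer_error g z d w (p := p)) u) ^t*) r 0)
             (to_vec (w p)) c,
         forall (j b : 'I_(K p.+1)) (i a : 'I_(K p)),
           error_hess g z d w p (mxvec_index j i) (mxvec_index b a) =
           N%:R^-1 * \sum_(t < N) gamma L g z w t p j b
                       * (act g z w t p i 0)^* * act g z w t p a 0
       & error_hess g z d w p \in unitmx ->
         pseudo_newton g z d w p =
         - (invmx (error_hess g z d w p) *m (error_grad g z d w p) ^t*)])
  /\
  (forall (mu : nat -> R) (w0 : weights R K) (n p : nat), (p < L)%N ->
     let W := backprop L (pseudo_newton g z d) mu w0 in
     let w := current L (pseudo_newton g z d) mu w0 n p in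
     admissible L g z Omega w ->
     error_hess g z d w p \in unitmx ->
     to_vec (W n.+1 p) =
     to_vec (W n p) + Complex (mu n) 0 *:
       (- (invmx (error_hess g z d w p) *m (error_grad g z d w p) ^t*))).
Proof.
have Omega_open p : (p < L)%N -> open (Omega p.+1 : set R[i]^o).
  by move=> pL; have [] := Omega_domain p.+1 pL.
have newton w p : pseudo_newton g z d w p =
    - (invmx (error_hess g z d w p) *m (error_grad g z d w p) ^t*).
  rewrite /pseudo_newton /pseudo_newton_update /newton_formula.
  by rewrite !mul0mx subr0 sub0r mulmxN.
split=> [w p adm pL|mu w0 n p pL W w adm unit_H].
  have g_holo q : (q < L)%N -> holomorphic_on (Omega q.+1) (g q.+1).
    by move=> qL; exact: (g_holomorphic q.+1 qL).
  have [d1 d2 _] := layer_error_derivatives d Omega_open g_holo p adm.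
  split.
  - exact: d1.
  - exact: d2.
  - move=> j b i a; apply: (error_hessE (Omega := Omega)) => //.
    + by move=> q s qL; exact: (Omega_conj q.+1 qL).
    + by move=> q s qL; exact: (g_conj q.+1 qL).
  - by rewrite newton.
by rewrite -newton; exact: backprop_layer.
Qed.
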